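(* Let $n\ge1$ and let $\mathbf e$ be a reverse Hessenberg function of length $n$. Then $$\chi_{\mathbf e}[X;q]=\sum_{\lambda\vdash n}Q_{\lambda'}[X;q^{-1}]\,\frac{q^{\binom{n+1}2-|\mathbf e|}}{(q-1)^{\lambda_1}}\Bigg(\sum_{T\in\mathrm{SYT}^{\mathbf e}_\lambda}\ \prod_{i\notin T_1}q^{-\mathrm m(T,i)-\mathrm d(T,i)}\prod_{\substack{i\notin T_1\\(T_{\prec i})_s=\emptyset}}[\mathrm d(T,i)]_q\prod_{\substack{i\notin T_1\\(T_{\prec i})_s\ne\emptyset}}\big[\mathrm L(T,i)-\mathrm{sh}(T_{<i})_{s+1}\big]_q\Bigg),$$ where in each factor indexed by $i\notin T_1$ the integer $s=s(T,i)\ge1$ is defined by: the entry $i$ lies in row $s+1$ of $T$ (rows numbered from $1$).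
   Context: A reverse Hessenberg function of length $n$ is a weakly increasing $\mathbf e:[n]\to\{0,\dots,n-1\}$ with $\mathbf e(i)<i$ for all $i$; $|\mathbf e|=\sum_i\mathbf e(i)$. Write $i\prec j$ if $\mathbf e(j)<i<j$, and $i\preceq j$ if $i\prec j$ or $i=j$. The unit interval graph $\Gamma_{\mathbf e}$ has vertex set $[n]$ and edges $\{i,j\}$ for $i\prec j$. $\chi_{\mathbf e}[X;q]=\sum_\kappa q^{\mathrm{asc}(\kappa)}\prod_v x_{\kappa(v)}$, sum over proper colorings $\kappa:[n]\to\mathbb Z_{>0}$ of $\Gamma_{\mathbf e}$, where $\mathrm{asc}(\kappa)$ is the number of edges $ij$ with $i<j$ and $\kappa(i)<\kappa(j)$. $Q_\mu[X;t]$ is the Hall--Littlewood $Q$-function in Macdonald's normalization, $Q_\mu[X;t]=b_\mu(t)P_\mu[X;t]$ with $b_\mu(t)=\prod_{i\ge1}\prod_{k=1}^{m_i(\mu)}(1-t^k)$, $m_i(\mu)$ the multiplicity of $i$ in $\mu$. $\lambda'$ is the conjugate partition. $[m]_q=(q^m-1)/(q-1)$. Tableaux are in French convention: row $1$ is the bottom row, and row $s+1$ lies directly above row $s$; columns are numbered from $0$. $\mathrm{SYT}^{\mathbf e}_\lambda$ is the set of standard Young tableaux $T$ of shape $\lambda$ such that for each $i$ the cells with entries $j\preceq i$ form a horizontal strip (no two cells in the same column). For such $T$: $T_1$ is the first row of $T$ ($i\notin T_1$ means the entry $i$ is not in it); $T_{\prec i}$ is the skew tableau formed by the entries $j\prec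 i$ and $(T_{\prec i})_s$ its part in row $s$; $\mathrm{sh}(T_{<i})$ is the partition formed by the cells with entries $<i$, with $k$-th part $\mathrm{sh}(T_{<i})_k$ (zero if beyond its length). With the entry $i$ in row $s+1$: - $\mathrm m(T,i)$ is the number of entries of $T_{\prec i}$ lying at least $2$ rows below the cell of $i$; - $\mathrm d(T,i)=\mathrm{sh}(T_{<i})_s-\mathrm{sh}(T_{<i})_{s+1}$; - if $(T_{\prec i})_s\ne\emptyset$, $\mathrm L(T,i)$ is the column (numbered from $0$) of the left-most cell of $T_{\prec i}$ in row $s$. *)

(* Defs.v *)
From mathcomp Require Import all_boot all_order all_fingroup all_algebra.
From mathcomp Require Import fraction.
From mathcomp.multinomials Require Import mpoly.

Set Implicit Arguments.
Unset Strict Implicit.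
Unset Printing Implicit Defensive.

Import GRing.Theory.
Local Open Scope ring_scope.

(* A symmetric function is given by the sequence of its images in N variables
   x_0, ..., x_(N-1), for all N (the other variables being set to 0): this is
   the inverse limit that defines the ring of symmetric functions.

   The set [n] = {1, ..., n} is represented by 'I_n, the ordinal i standing for
   i + 1.  For e on [n], the value (e i : nat) is the one at i + 1. *)

Section Hessenberg.
Variables (n : nat) (e : 'I_n -> 'I_n).

Definition rev_hessenberg : Prop :=
  {homo e : i j / (i <= j)%N} /\ (forall i : 'I_n, (e i < i.+1)%N).

Definition hsize : nat := (\sum_(i < n) e i)%N.

Definition prec (i j : 'I_n) : bool := (e j < i.+1)%N && (i < j)%N.
Definition preceq (i j : 'I_n) : bool := prec i j || (i == j).

(* prec i j implies i < j, so each edge {i, j} is listed once, as (i, j) with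
   i < j. *)
Definition proper_coloring (N : nat) (kappa : {ffun 'I_n -> 'I_N}) : bool :=
  [forall i, forall j, prec i j ==> (kappa i != kappa j)].

Definition asc (N : nat) (kappa : {ffun 'I_n -> 'I_N}) : nat :=
  #|[set p : 'I_n * 'I_n | prec p.1 p.2 & (kappa p.1 < kappa p.2)%N]|.

(* The image in N variables of the sum over all colorings by positive integers:
   a coloring using a color beyond the first N contributes 0. *)
Definition chromatic (K : comNzRingType) (N : nat) (q : K) : {mpoly K[N]} :=
  \sum_(kappa : {ffun 'I_n -> 'I_N} | proper_coloring kappa)
    q ^+ asc kappa *: \prod_(v < n) 'X_(kappa v).

End Hessenberg.

(* A partition of n has at most n parts, each at most n; it is represented by
   its parts in decreasing order, padded with zeros to length n. *)
Definition parts (n : nat) (lam : n.-tuple 'I_n.+1) : seq nat :=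
  [seq nat_of_ord p | p <- lam].

Definition is_partition (n : nat) (lam : n.-tuple 'I_n.+1) : bool :=
  sorted geq (parts lam) && (sumn (parts lam) == n).

(* The conjugate has no zero part, and its length is the first part. *)
Definition conj_part (lam : seq nat) : seq nat :=
  [seq count (fun p => j < p)%N lam | j <- iota 0 (head 0%N lam)].

(* mu is a partition without zero parts. *)

Section HallLittlewood.
Variables (K : fieldType) (N : nat).
Implicit Types (mu : seq nat) (t : K).

Definition scal (c : K) : {fraction {mpoly K[N]}} := tofrac c%:MP_[N].
Definition xvar (i : 'I_N) : {fraction {mpoly K[N]}} := tofrac ('X_i : {mpoly K[N]}).

Definition mult mu (i : nat) : nat := count_mem i mu.

Definition HL_b mu t : K :=
  \prod_(1 <= i < (head 0%N mu).+1) \prod_(1 <= k < (mult mu i).+1) (1 - t ^+ k).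

Definition HL_vm (m : nat) t : K :=
  \prod_(1 <= k < m.+1) ((1 - t ^+ k) / (1 - t)).

(* The first factor is for the part 0, of multiplicity N - l(mu). *)
Definition HL_v mu t : K :=
  HL_vm (N - size mu) t *
  \prod_(1 <= i < (head 0%N mu).+1) HL_vm (mult mu i) t.

Definition HL_R mu t : {fraction {mpoly K[N]}} :=
  \sum_(w : 'S_N)
    (\prod_(i < N) xvar (w i) ^+ nth 0%N mu i) *
    \prod_(i < N) \prod_(j < N | (i < j)%N)
      ((xvar (w i) - scal t * xvar (w j)) / (xvar (w i) - xvar (w j))).

(* P_mu(x_1, ..., x_N; t) is HL_R / HL_v if l(mu) <= N, and 0 otherwise. *)
Definition HL_P mu t : {fraction {mpoly K[N]}} :=
  if (size mu <= N)%N then scal (HL_v mu t)^-1 * HL_R mu t else 0.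

Definition HL_Q mu t : {fraction {mpoly K[N]}} := scal (HL_b mu t) * HL_P mu t.

End HallLittlewood.

(* A filling T maps the entry i to its cell (row, column), both numbered from
   0: row r here is row r + 1 in the usual numbering from 1.  French
   convention: row 0 is the bottom row. *)

Section Tableaux.
Variables (n : nat) (e : 'I_n -> 'I_n).
Implicit Types (T : {ffun 'I_n -> 'I_n * 'I_n}) (i : 'I_n).

Definition trow T i : nat := (T i).1.
Definition tcol T i : nat := (T i).2.

Definition is_SYT (lam : seq nat) T : bool :=
  [&& injectiveb T,
      [set T i | i : 'I_n] ==
        [set c : 'I_n * 'I_n | (c.2 < nth 0%N lam c.1)%N],
      [forall i, forall j,
        ((trow T i == trow T j) && (tcol T i < tcol T j)%N) ==> (i < j)%N]
    & [forall i, forall j,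
        ((tcol T i == tcol T j) && (trow T i < trow T j)%N) ==> (i < j)%N]].

Definition is_SYTe (lam : seq nat) T : bool :=
  is_SYT lam T &&
  [forall i, forall j, forall k,
    [&& preceq e j i, preceq e k i & j != k] ==> (tcol T j != tcol T k)].

(* The length of row r in the shape of the entries < i. *)
Definition sh_lt T i (r : nat) : nat :=
  #|[set j : 'I_n | (j < i)%N & trow T j == r]|.

Definition stat_m T i : nat :=
  #|[set j : 'I_n | prec e j i & ((trow T j).+2 <= trow T i)%N]|.

(* For an entry i not in the bottom row, the row s + 1 of i, for s >= 1, is the
   row trow T i here, and the row s is (trow T i).-1. *)
Definition stat_d T i : int :=
  (sh_lt T i (trow T i).-1)%:Z - (sh_lt T i (trow T i))%:Z.

Definition prec_below T i : {set 'I_n} :=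
  [set j : 'I_n | prec e j i & (trow T j).+1 == trow T i].

(* Meaningful only if prec_below T i is nonempty; columns are < n. *)
Definition stat_L T i : nat := \big[minn/n]_(j in prec_below T i) tcol T j.

Variables (K : fieldType) (q : K).

Definition qint (m : int) : K := (q ^ m - 1) / (q - 1).

Definition tab_weight T : K :=
  (\prod_(i < n | (0 < trow T i)%N) q ^ (- (stat_m T i)%:Z - stat_d T i)) *
  (\prod_(i < n | (0 < trow T i)%N && (prec_below T i == set0))
     qint (stat_d T i)) *
  (\prod_(i < n | (0 < trow T i)%N && (prec_below T i != set0))
     qint ((stat_L T i)%:Z - (sh_lt T i (trow T i))%:Z)).

End Tableaux.

Definition Qq : fieldType := {fraction {poly rat}}.
Definition qq : Qq := tofrac ('X : {poly rat}).

(* Main.v *)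
Require Import Defs.
From HB Require Import structures.
From mathcomp Require Import all_boot all_order all_fingroup all_algebra.
From mathcomp Require Import fraction zify ring.
From mathcomp.multinomials Require Import mpoly.

Set Implicit Arguments.
Unset Strict Implicit.
Unset Printing Implicit Defensive.

Import GRing.Theory.
Local Open Scope ring_scope.

(** Let the Hecke algebra act on functions of x_0, ..., x_(N-1) by the
    Demazure-Lusztig operators T_i. Read the vertices one by one, remembering
    the colors of the current window of mutually adjacent vertices. The
    generating functions of the colorings with a prescribed window are exchanged
    by the T_i, so all of them are determined by the one whose window is 0, ...,
    k-1 (most recent vertex first). On that one, a new vertex acts as
    X_0 T_0 ... T_(k-1) and forgetting the oldest vertex of the window acts as a
    partial Hecke symmetrization.

    In the basis E_alpha of the polynomials obtained from the monomials with
    increasing exponents by the T_i, the operator X_0 T_0 ... T_(N-2) merely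
    moves the last entry g of alpha to the front and turns it into g + 1. Hence,
    after Hecke symmetrization of the positions outside the window, a new vertex
    puts a box on top of a column, of height g, that does not belong to the
    window, with a coefficient that is a power of q times the q-number of such
    columns; forgetting a vertex has coefficient 1. The chromatic function is
    thus a sum over tableaux of symmetrized monomials, that is, of
    Hall-Littlewood functions at 1/q, and the coefficients are those of the
    statement. *)

(** Polynomials are replaced by values: the operators act on functions on ['S_N], that is, on the
    values at all permutations of one point, namely the point of the variables in the fraction
    field. Division by x_i - x_(i+1) becomes division by a nonzero scalar. The combinatorial part
    needs only relations of the affine Hecke algebra and is carried out in an abstract module. The
    bridge to Hall-Littlewood functions is a linear form, the sum over ['S_N] against the product
    over i < j of (x_i - q x_j)/(x_i - x_j). It turns every T_i into multiplication by q and
    multiplies symmetric functions by [N]_q!. On monomials it gives the Hall-Littlewood sum, with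
    parameter 1/q because the order of the variables has to be reversed. On the tableau side, the
    two kinds of q-numbers of the statement are one: for an entry i in row g+1 (rows from 0), both
    have as argument the number of entries of row g older than the window of i, minus the number of
    entries < i in row g+1. A tableau is stored as the word of the rows of its entries; a word that
    gives no admissible tableau has weight 0. *)

Lemma perm_swap (A : eqType) (u : seq A) a b v :
  perm_eq (u ++ a :: b :: v) (u ++ b :: a :: v).
Proof. by apply/seq.permP => P; rewrite !count_cat /=; ring. Qed.

(** An adjacent swap is what a single generator T_i can realize, so the hypothesis asks for nothing
    more. The letters already placed are kept in a prefix over which the induction is
    generalized. *)
Lemma perm_swap_ind (A : eqType) (P : seq A -> Prop) :
  (forall u a b v, P (u ++ a :: b :: v) -> P (u ++ b :: a :: v)) ->
  forall s t, perm_eq s t -> P s -> P t.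
Proof.
move=> hP s t hst; rewrite -[s]cat0s -[t]cat0s.
elim: s [::] t hst => [|a s IH] u t.
  by rewrite perm_sym => /perm_nilP ->.
move=> hst; have ha : a \in t by rewrite -(perm_mem hst) mem_head.
case/splitPr: ha hst => t1 t2 hst.
have {}hst : perm_eq s (t1 ++ t2).
  by rewrite -(perm_cons a) (permPl hst) -cat1s perm_catCA.
rewrite -cat_rcons => /(IH _ _ hst); rewrite cat_rcons.
elim: t1 u {hst} => //= b t1 IHt u /hP.
by rewrite -[u ++ b :: t1 ++ _]cat_rcons -[u ++ b :: _]cat_rcons; apply: IHt.
Qed.

Fixpoint inversions (s : seq nat) : nat :=
  if s is a :: s' then (count (fun b => b < a) s' + inversions s')%N else 0%N.

Lemma inversions_cat_cons u g v :
  inversions (u ++ g :: v) =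
  (inversions (u ++ v) + count (fun b => g < b) u + count (fun b => b < g) v)%N.
Proof.
elim: u => [|a u IH] /=; [by rewrite ?addn0 addnC| rewrite IH !count_cat /=].
by ring.
Qed.

Lemma nth_lt_count s a p : sorted leq s -> (p < size s)%N ->
  (nth 0 s p < a)%N = (p < count (fun b => b < a) s)%N.
Proof.
elim: s p => // c s IH p hs hp.
have hcs : all (leq c) s by exact: order_path_min leq_trans hs.
case: p hp => [|p] hp /=.
  have [hca|hca] := ltnP c a; first by rewrite add1n.
  suff -> : count (fun b => (b < a)%N) s = 0%N by [].
  apply/eqP; rewrite -leqn0 leqNgt -has_count -all_predC.
  by apply: sub_all hcs => b /= hb; rewrite -leqNgt (leq_trans hca).
rewrite IH ?(path_sorted hs) //.
have [hca|hca] := ltnP c a; first by rewrite add1n ltnS.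
suff -> : count (fun b => (b < a)%N) s = 0%N by [].
apply/eqP; rewrite -leqn0 leqNgt -has_count -all_predC.
by apply: sub_all hcs => b /= hb; rewrite -leqNgt (leq_trans hca).
Qed.

(** A position is encoded by its letter and the rank of that occurrence. Sums over ranks are how the
    q-numbers of columns of equal height arise. *)
Lemma sum_by_value (R : nmodType) (F : nat -> nat -> R) B s :
  all (fun b => b < B)%N s ->
  \sum_(p < size s) F (nth 0%N s p) (count_mem (nth 0%N s p) (take p s)) =
  \sum_(g < B) \sum_(r < count_mem (g : nat) s) F g r.
Proof.
elim/last_ind: s => [|s x IH].
  by rewrite /= big_ord0 big1 // => g _; rewrite big_ord0.
rewrite all_rcons => /andP[hx hs].
rewrite size_rcons big_ord_recr /= nth_rcons ltnn eqxx -cats1 take_size_cat //.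
under eq_bigr => p _ do
  rewrite nth_cat ltn_ord takel_cat ?(ltnW (ltn_ord p)) //.
rewrite IH // (bigD1 (Ordinal hx)) //= [in RHS](bigD1 (Ordinal hx)) //=.
rewrite count_cat /= eqxx addn0 addn1 big_ord_recr /= addrAC; congr (_ + _ + _).
apply: eq_bigr => g; rewrite -val_eqE /= => hg.
by rewrite count_cat /= eq_sym (negPf hg) !addn0.
Qed.

Lemma inv_sorted s : sorted leq s -> inversions s = 0%N.
Proof.
elim: s => //= a s IH hs; rewrite IH ?(path_sorted hs) // addn0.
apply/eqP; rewrite -leqn0 leqNgt -has_count -all_predC.
have: all (leq a) s by exact: order_path_min leq_trans hs.
by apply: sub_all => b /=; rewrite -leqNgt.
Qed.

Fixpoint words (B i : nat) : seq (seq nat) :=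
  if i is i'.+1 then [seq g :: s | s <- words B i', g <- iota 0 B] else [:: [::]].

Lemma sum_words (R : nmodType) B i (F : seq nat -> R) :
  \sum_(s <- words B i.+1) F s = \sum_(s <- words B i) \sum_(g < B) F (nat_of_ord g :: s).
Proof.
rewrite /= big_allpairs_dep; apply: eq_bigr => s _.
by rewrite -(big_mkord xpredT (fun g => F (g :: s))) /index_iota subn0.
Qed.

Lemma mem_words B i s : (s \in words B i) = (size s == i) && all (fun g => g < B)%N s.
Proof.
elim: i s => [|i IH] [|g s] //=.
  by apply/negbTE/negP => /allpairsPdep[? [? [_ _]]].
apply/allpairsPdep/idP => [[s' [g' [hs hg [-> ->]]]]|].
  by move: hs hg; rewrite IH mem_iota eqSS add0n => /andP[-> ->] /andP[_ ->].
rewrite eqSS => /and3P[h1 h2 h3]; exists s, g; split=> //.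
  by rewrite IH h1.
by rewrite mem_iota.
Qed.

Definition swap_succ (a x : nat) : nat :=
  if x == a then a.+1 else if x == a.+1 then a else x.

Lemma swap_succK a : involutive (swap_succ a).
Proof.
move=> x; rewrite /swap_succ; have [->|h] := eqVneq x a; first by rewrite eqn_leq ltnn eqxx.
have [->|h'] := eqVneq x a.+1; first by rewrite eqxx.
by rewrite (negPf h) (negPf h').
Qed.

Lemma swap_succ_lt a x B : (a.+1 < B)%N -> (x < B)%N -> (swap_succ a x < B)%N.
Proof. by rewrite /swap_succ; do 2?case: eqP => _; lia. Qed.

Lemma map_sw_id a s : a \notin s -> a.+1 \notin s -> map (swap_succ a) s = s.
Proof.
move=> h1 h2; rewrite -[RHS]map_id; apply/eq_in_map => x hx /=; rewrite /swap_succ.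
case: eqP => [e|_]; first by rewrite -e hx in h1.
by case: eqP => [e|_] //; rewrite -e hx in h2.
Qed.

Lemma count_blocks (f : nat -> nat) B h :
  count_mem h (flatten [seq nseq (f g) g | g <- iota 0 B]) =
  if (h < B)%N then f h else 0%N.
Proof.
elim: B => // B IH; rewrite -[in LHS]addn1 iotaD map_cat flatten_cat count_cat IH.
rewrite /= cats0 count_nseq /= ltnS.
by case: (ltngtP h B) => [||->]; rewrite ?mul0n ?mul1n ?addn0.
Qed.

(** * Symmetrization in a module over the Hecke algebra *)

Section HeckeModule.
Variables (L : fieldType) (V : lmodType L) (q : L) (N : nat).
Variables (T : nat -> {linear V -> V}).
Hypothesis q_neq0 : q != 0.
Hypothesis T_quad : forall i v, (i.+1 < N)%N ->
  T i (T i v) = (q - 1) *: T i v + q *: v.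
Hypothesis T_braid : forall i v, (i.+2 < N)%N ->
  T i (T i.+1 (T i v)) = T i.+1 (T i (T i.+1 v)).
Hypothesis T_far : forall i j v, (i.+1 < j)%N -> (j.+1 < N)%N ->
  T i (T j v) = T j (T i v).

Lemma T_comm i j v : (i.+1 < j)%N || (j.+1 < i)%N ->
  (i.+1 < N)%N -> (j.+1 < N)%N -> T i (T j v) = T j (T i v).
Proof. by case/orP => h hi hj; [exact: T_far | exact/esym/T_far]. Qed.

(** As a product, T_(j+l-1) ... T_(j+1) T_j: it carries the letter at position j to position j+l. *)
Fixpoint up (j l : nat) (v : V) : V :=
  if l is l'.+1 then T (j + l') (up j l' v) else v.

Lemma up_is_linear j l : linear (up j l).
Proof. by elim: l => // l IH a u v /=; rewrite IH linearP. Qed.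
HB.instance Definition _ j l :=
  GRing.isLinear.Build L V V *:%R (up j l) (up_is_linear j l).

Lemma up_recl j l v : up j l.+1 v = up j.+1 l (T j v).
Proof.
elim: l => [|l IH]; first by rewrite /= addn0.
by rewrite -[LHS]/(T (j + l.+1)%N (up j l.+1 v)) IH /= addnS addSn.
Qed.

Lemma up_intertwine (A : V -> V) (a b l : nat) :
  (forall i v, (i < l)%N -> A (T (a + i) v) = T (b + i) (A v)) ->
  forall c d v, (c + d <= l)%N -> A (up (a + c) d v) = up (b + c) d (A v).
Proof.
move=> hA c; elim=> //= d IH v hcd.
by rewrite -!addnA hA ?addnA ?IH //; lia.
Qed.

Lemma up_intertwine0 (A : V -> V) (a b l : nat) :
  (forall i v, (i < l)%N -> A (T (a + i) v) = T (b + i) (A v)) ->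
  forall d v, (d <= l)%N -> A (up a d v) = up b d (A v).
Proof. by move=> hA d v hd; have := up_intertwine hA (c := 0) v hd; rewrite !addn0. Qed.

(** One braid move lowers the index; all the other factors commute with the generator. *)
Lemma up_T j l i v : (i.+1 < l)%N -> (j + l < N)%N ->
  up j l (T (j + i.+1) v) = T (j + i) (up j l v).
Proof.
elim: l i v => // l IH i v; rewrite ltnS leq_eqVlt => /orP[/eqP <-|hil] hN /=.
  have -> : up j i (T (j + i.+1) v) = T (j + i.+1) (up j i v).
    rewrite (up_intertwine0 (A := T (j + i.+1)) (b := j) (l := i)) //.
    by move=> k u hk; rewrite T_comm //; lia.
  by rewrite addnS T_braid //; lia.
by rewrite IH // 1?T_comm //; lia.
Qed.

Lemma up_far j l k v : (k.+1 < j)%N || (j + l < k)%N ->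
  (k.+1 < N)%N -> (l = 0 \/ j + l < N)%N -> up j l (T k v) = T k (up j l v).
Proof.
move=> hk hkN [->//|hN].
rewrite (up_intertwine0 (A := T k) (b := j) (l := l)) //.
by move=> i u hi; rewrite T_comm //; lia.
Qed.

(** In the group permuting the positions j, ..., j+l, [symC] runs over the minimal representatives
    of the left cosets of the stabilizer of j, and [symD] over those of the right cosets of the
    stabilizer of j+l. *)
Definition symC (j l : nat) (v : V) : V := \sum_(c < l.+1) up j c v.
Definition symD (j l : nat) (v : V) : V := \sum_(c < l.+1) up (j + c) (l - c) v.

Lemma symC_is_linear j l : linear (symC j l).
Proof.
move=> a u v; rewrite /symC scaler_sumr -big_split.
by apply: eq_bigr => c _; rewrite linearP.
Qed.
HB.instance Definition _ j l :=
  GRing.isLinear.Build L V V *:%R (symC j l) (symC_is_linear j l).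

Lemma symD_is_linear j l : linear (symD j l).
Proof.
move=> a u v; rewrite /symD scaler_sumr -big_split.
by apply: eq_bigr => c _; rewrite linearP.
Qed.
HB.instance Definition _ j l :=
  GRing.isLinear.Build L V V *:%R (symD j l) (symD_is_linear j l).

(* The sum of the T_w for w in the group generated by s_j, ..., s_(j+l-1). *)
Fixpoint hecke_sym (j l : nat) (v : V) : V :=
  if l is l'.+1 then symC j l (hecke_sym j.+1 l' v) else v.

Lemma hecke_sym_is_linear j l : linear (hecke_sym j l).
Proof. by elim: l j => // l IH j a u v /=; rewrite IH linearP. Qed.
HB.instance Definition _ j l :=
  GRing.isLinear.Build L V V *:%R (hecke_sym j l) (hecke_sym_is_linear j l).

Lemma hecke_sym_intertwine (A : {additive V -> V}) (a b l : nat) :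
  (forall i v, (i < l)%N -> A (T (a + i) v) = T (b + i) (A v)) ->
  forall v, A (hecke_sym a l v) = hecke_sym b l (A v).
Proof.
elim: l a b => // l IH a b hA v /=.
rewrite -(IH a.+1 b.+1); last first.
  by move=> i u hi; rewrite !addSnnS hA.
rewrite /symC raddf_sum; apply: eq_bigr => c _.
by rewrite (up_intertwine0 hA) // -ltnS.
Qed.

(** The definition peels off the first position; here the last one is peeled off, with the
    representatives on the side of the argument. The longest product in [symC] passes through the
    smaller symmetrizer by [up_T], and the pieces reassemble by induction. *)
Lemma hecke_sym_factor j l v : (j + l.+1 < N)%N ->
  hecke_sym j l.+1 v = hecke_sym j l (symD j l.+1 v).
Proof.
elim: l j v => [|l IH] j v hN.
  by rewrite /= /symC /symD !big_ord_recl !big_ord0 /= !addr0 !addn0 addrC.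
have hD u : symD j l.+2 u = up j l.+2 u + symD j.+1 l.+1 u.
  rewrite /symD big_ord_recl subn0 addn0; congr (_ + _).
  by apply: eq_bigr => c _; rewrite /= addnS addSn subSS.
have hC u : symC j l.+2 u = symC j l.+1 u + up j l.+2 u.
  by rewrite /symC big_ord_recr.
rewrite -[LHS]/(symC j l.+2 (hecke_sym j.+1 l.+1 v)) hC IH; last by lia.
rewrite hD linearD addrC; congr (_ + _).
have -> : up j l.+2 (hecke_sym j.+1 l (symD j.+1 l.+1 v)) =
          hecke_sym j l (up j l.+2 (symD j.+1 l.+1 v)).
  apply: (hecke_sym_intertwine (A := up j l.+2)) => i u hi.
  by rewrite addSnnS; apply: up_T; lia.
rewrite -[RHS]/(hecke_sym j l.+1 (up j l.+2 v)) IH; last by lia.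
congr (hecke_sym _ _ _); rewrite /symD linear_sum; apply: eq_bigr => c _.
apply: (up_intertwine (A := up j l.+2) (l := l.+1)); last by have := ltn_ord c; lia.
by move=> i u hi; rewrite addSnnS; apply: up_T; lia.
Qed.

(** By the quadratic relation, the summands c = i and c = i+1 of [symC] add up to an eigenvector. In
    any other summand the generator passes through [up], with its index possibly shifted, and
    reaches the inner symmetrizer. *)
Lemma T_hecke_sym j l i v : (i < l)%N -> (j + l < N)%N ->
  T (j + i) (hecke_sym j l v) = q *: hecke_sym j l v.
Proof.
elim: l j i v => // l IH j i v hi hN.
rewrite -[hecke_sym j l.+1 v]/(symC j l.+1 (hecke_sym j.+1 l v)).
set w := hecke_sym j.+1 l v.
have hw k : (0 < k)%N -> (k <= l)%N -> T (j + k) w = q *: w.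
  by case: k => // k _ hk; rewrite -addSnnS IH //; lia.
apply/eqP; rewrite -subr_eq0 /symC linear_sum scaler_sumr -sumrB.
have hi1 : (i.+1 < l.+2)%N by lia.
have hi0 : (i < l.+2)%N by lia.
rewrite (bigD1 (Ordinal hi0)) //= (bigD1 (Ordinal hi1)) /=; last first.
  by rewrite -val_eqE /=; lia.
rewrite big1 ?addr0; last first.
  move=> c /andP[]; rewrite -!val_eqE /= => h1 h2.
  apply/eqP; rewrite subr_eq0; apply/eqP.
  have hc := ltn_ord c.
  have [hci|hci] := ltnP c i.
    rewrite -up_far ?hw ?linearZ //; try lia.
  case hcc : (c : nat) hci h1 h2 hc => [|c'] hci h1 h2 hc; first by lia.
  rewrite -up_T; [|lia|lia].
  by rewrite hw ?linearZ //; lia.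
rewrite T_quad; last by lia.
apply/eqP; rewrite scalerBl scale1r /=; set a := T _ _; set b := _ *: up _ _ _.
set x := q *: a.
rewrite [_ + b - x]addrAC [x - a]addrC addrK [- a + b]addrC addrA subrK.
by rewrite subrr.
Qed.

(** Mirror image of [T_hecke_sym], obtained from the factorization through [symD]. *)
Lemma hecke_sym_T j l i v : (i < l)%N -> (j + l < N)%N ->
  hecke_sym j l (T (j + i) v) = q *: hecke_sym j l v.
Proof.
elim: l i v => // l IH i v hi hN.
rewrite !hecke_sym_factor; try lia.
apply/eqP; rewrite -subr_eq0 -linearZ -linearB /symD.
have hi1 : (i.+1 < l.+2)%N by lia.
have hi0 : (i < l.+2)%N by lia.
rewrite scaler_sumr -sumrB linear_sum /=.
rewrite (bigD1 (Ordinal hi0)) //= (bigD1 (Ordinal hi1)) /=; last first.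
  by rewrite -val_eqE /=; lia.
rewrite big1 ?addr0; last first.
  move=> c /andP[]; rewrite -!val_eqE /= => h1 h2.
  have hc := ltn_ord c; rewrite linearB linearZ /=.
  apply/eqP; rewrite subr_eq0; apply/eqP.
  have [hci|hci] := ltnP c i.
    case: i hi hi0 hi1 h1 h2 hci => [|i] hi hi0 hi1 h1 h2 hci; first by lia.
    have -> : (j + i.+1 = j + c + (i - c).+1)%N by lia.
    rewrite up_T; [|lia|lia].
    by have -> : (j + c + (i - c) = j + i)%N by [lia]; rewrite IH //; lia.
  by rewrite up_far ?IH //; lia.
have hs : (l.+1 - i = (l.+1 - i.+1).+1)%N by lia.
rewrite -linearD /= hs ![up (j + i) _ _]up_recl T_quad; last by lia.
rewrite -addnS [X in hecke_sym _ _ X](_ : _ = 0) ?linear0 //.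
rewrite [up _ _ (_ + _)]linearD !linearZ /=; set a := up _ _ (T _ v); set b := up _ _ v.

rewrite !scalerN scalerBl scale1r; set x := q *: a; set y := q *: b.
rewrite [_ + y - x]addrAC [x - a]addrC addrK [- a + y]addrC addrA subrK.
by rewrite subrr.
Qed.

(** * Affine Hecke relations, inverse generators, monomials and the basis E_alpha *)

Variables (X : nat -> {linear V -> V}) (v1 : V).
Hypothesis T_X : forall i v, (i.+1 < N)%N -> T i (X i (T i v)) = q *: X i.+1 v.
Hypothesis T_X_far : forall i j v, (i.+1 < N)%N -> j != i -> j != i.+1 ->
  T i (X j v) = X j (T i v).
Hypothesis X_comm : forall i j v, X i (X j v) = X j (X i v).
Hypothesis T_v1 : forall i, (i.+1 < N)%N -> T i v1 = q *: v1.

Definition Tinv (i : nat) (v : V) : V := q^-1 *: (T i v - (q - 1) *: v).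

Lemma TK i v : (i.+1 < N)%N -> Tinv i (T i v) = v.
Proof. by move=> hi; rewrite /Tinv T_quad // addrC addKr scalerK. Qed.

Lemma TinvK i v : (i.+1 < N)%N -> T i (Tinv i v) = v.
Proof. by move=> hi; rewrite /Tinv linearZ linearB linearZ /= T_quad // addrC addKr scalerK. Qed.

Lemma TinvZ i c v : Tinv i (c *: v) = c *: Tinv i v.
Proof.
by rewrite /Tinv linearZ /= [(q - 1) *: _]scalerA [_ * c]mulrC -scalerA -scalerBr !scalerA mulrC.
Qed.

Fixpoint up_inv (o j : nat) (v : V) : V :=
  if j is j'.+1 then up_inv o j' (Tinv (o + j') v) else v.

Lemma up_invK o l v : (l = 0 \/ o + l < N)%N -> up o l (up_inv o l v) = v.
Proof.
case=> [->//|]; elim: l v => //= l IH v hl.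
by rewrite IH ?TinvK //; lia.
Qed.

Lemma upK o l v : (l = 0 \/ o + l < N)%N -> up_inv o l (up o l v) = v.
Proof.
case=> [->//|]; elim: l v => //= l IH v hl.
by rewrite TK ?IH //; lia.
Qed.

Lemma up_inv_recl o l v : up_inv o l.+1 v = Tinv o (up_inv o.+1 l v).
Proof. by elim: l v => [|l IH] v; rewrite /= ?addn0 // -IH /= addSnnS. Qed.

Lemma T_up_inv o l i v : (i.+1 < l)%N -> (o + l < N)%N ->
  T (o + i.+1) (up_inv o l v) = up_inv o l (T (o + i) v).
Proof.
move=> hi hl; rewrite -[LHS](@upK o l) ?up_T ?up_invK //; by right.
Qed.

Lemma T_up_inv_far o l k v : (k.+1 < o)%N || (o + l < k)%N ->
  (k.+1 < N)%N -> (l = 0 \/ o + l < N)%N -> T k (up_inv o l v) = up_inv o l (T k v).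
Proof.
move=> hk hkN hl; rewrite -[LHS](@upK o l) // up_far ?up_invK //.
Qed.

(** Inverse form of [up_T], iterated. It compares [Eop] on two words that differ by a swap of
    adjacent letters. *)
Lemma up_inv_up_inv o d l v : (d < l)%N -> (o + l < N)%N ->
  up_inv o.+1 d (up_inv o l v) = up_inv o l (up_inv o d v).
Proof.
move=> hd hl; rewrite -[RHS](@upK o.+1 d); last by right; lia.
congr (up_inv _ _ _); rewrite -[in RHS](addn1 o).
rewrite -(up_intertwine0 (A := up_inv o l) (a := o) (l := l.-1)); [|move=> i u hi|lia].
  by rewrite up_invK //; right; lia.
by rewrite -addnA add1n T_up_inv //; lia.
Qed.

Fixpoint monom (i : nat) (s : seq nat) : V :=
  if s is b :: s' then iter b (X i) (monom i.+1 s') else v1.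

Lemma T_iterX i j b v : (i.+1 < N)%N -> j != i -> j != i.+1 ->
  T i (iter b (X j) v) = iter b (X j) (T i v).
Proof. by move=> *; elim: b => //= b IH; rewrite T_X_far // IH. Qed.

Lemma iterX_comm i j b v : X i (iter b (X j) v) = iter b (X j) (X i v).
Proof. by elim: b => //= b IH; rewrite X_comm IH. Qed.

Lemma iterXZ i b c v : iter b (X i) (c *: v) = c *: iter b (X i) v.
Proof. by elim: b => //= b ->; rewrite linearZ. Qed.

Lemma T_XX i v : (i.+1 < N)%N -> T i (X i (X i.+1 v)) = X i (X i.+1 (T i v)).
Proof.
move=> hi; have hX u : X i.+1 u = q^-1 *: T i (X i (T i u)).
  by rewrite T_X // scalerK.
by rewrite [in LHS]hX !linearZ /= T_X // scalerA mulVf // scale1r X_comm.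
Qed.

Lemma T_monom_far j i s : (j.+1 < i)%N -> (j.+1 < N)%N -> T j (monom i s) = q *: monom i s.
Proof.
elim: s i => [|b s IH] i hj hN /=; first exact: T_v1.
by rewrite T_iterX ?IH ?iterXZ //; lia.
Qed.

(** Two equal exponents form a power of X_i X_(i+1), which commutes with T_i by [T_XX]; the
    generator thus reaches [v1]. *)
Lemma T_monom i u a v : ((i + size u).+1 < N)%N ->
  T (i + size u) (monom i (u ++ a :: a :: v)) = q *: monom i (u ++ a :: a :: v).
Proof.
elim: u i => [|b u IH] i hi /=; last first.
  rewrite -addSnnS T_iterX; [|rewrite /= in hi; lia..].
  by rewrite IH ?iterXZ // addSnnS.
rewrite addn0 in hi *.
have h w : iter a (X i) (iter a (X i.+1) w) = iter a (fun w => X i (X i.+1 w)) w.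
  by elim: a w => //= a IH w; rewrite -iterX_comm IH.
rewrite h; have -> w : T i (iter a (fun w => X i (X i.+1 w)) w) =
   iter a (fun w => X i (X i.+1 w)) (T i w).
  by elim: a {h} => //= a IH; rewrite T_XX // IH.
rewrite T_monom_far //.
by elim: a {h} => //= a ->; rewrite !linearZ.
Qed.

Lemma X_monom i u g v :
  X (i + size u) (monom i (u ++ g :: v)) = monom i (u ++ g.+1 :: v).
Proof.
by elim: u i => [|b u IH] i /=; rewrite ?addn0 // iterX_comm -addSnnS IH.
Qed.

(** The counts are the Lehmer code of [s]: in the sorted word the first copy of [a] has that index,
    and [up_inv] brings it to the front by inverse generators, one for each smaller letter that it
    crosses. *)
Fixpoint Eop (o : nat) (s : seq nat) (v : V) : V :=
  if s is a :: s' then Eop o.+1 s' (up_inv o (count (fun b => (b < a)%N) s') v)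
  else v.

Lemma Eop_far o s k v : (k.+1 < o)%N -> (o + size s <= N)%N -> (k.+1 < N)%N ->
  T k (Eop o s v) = Eop o s (T k v).
Proof.
elim: s o v => //= a s IH o v hk hs hN.
have hc := count_size (fun b => (b < a)%N) s.
rewrite IH; try lia.
by rewrite T_up_inv_far ?hk //; lia.
Qed.

Lemma T_Eop_desc o u a b v x : (b < a)%N ->
  (o + size (u ++ a :: b :: v) <= N)%N ->
  T (o + size u) (Eop o (u ++ a :: b :: v) x) = Eop o (u ++ b :: a :: v) x.
Proof.
move=> hab; elim: u o x => [|c u IH] o x /= hs; last first.
  rewrite -addSnnS IH; last by lia.
  congr (Eop _ _ (up_inv _ _ _)); rewrite !count_cat /=; ring.
have hv := count_size (fun y => (y < b)%N) v.
have hv' := count_size (fun y => (y < a)%N) v.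
have hc : (count (fun y => y < b) v <= count (fun y => y < a) v)%N.
  by apply: sub_count => y /=; lia.
rewrite addn0 Eop_far; try lia.
rewrite hab (leq_gtF (ltnW hab)) add0n add1n up_inv_up_inv; try lia.
by rewrite up_inv_recl TinvK //; lia.
Qed.

(** The generator at two equal letters becomes the generator at two adjacent positions of the sorted
    word. The bounds on p suffice: in the sorted word, both p and p+1 then carry the letter [a]. *)
Lemma T_Eop_eq o u a v x : (o + size (u ++ a :: a :: v) <= N)%N ->
  exists2 p, (count (fun b => b < a) (u ++ v) <= p
              <= count (fun b => b < a.+1) (u ++ v))%N &
  T (o + size u) (Eop o (u ++ a :: a :: v) x) =
  Eop o (u ++ a :: a :: v) (T (o + p) x).
Proof.
elim: u o x => [|c u IH] o x /= hs.
  have hv := count_size (fun y => (y < a)%N) v.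
  exists (count (fun b => (b < a)%N) v).
    by rewrite leqnn /=; apply: sub_count => y /=; lia.
  rewrite addn0 Eop_far; try lia.
  rewrite ltnn add0n; congr (Eop _ _ _); set c := count _ v.
  have -> : up_inv o.+1 c (up_inv o c x) = up_inv o.+1 c (up_inv o c.+1 (T (o + c) x)).
    by rewrite /= TK //; lia.
  by rewrite up_inv_up_inv; [rewrite up_inv_recl TinvK //; lia|lia|lia].
move: (hs); rewrite -addSnnS => hs1.
have [p hp hT] := IH o.+1 (up_inv o (count (fun b => (b < c)%N) (u ++ a :: a :: v)) x) hs1.
rewrite -addSnnS hT; set j := count _ (_ ++ _ :: _).
have hj : j = (count (fun b => b < c) (u ++ v) + (a < c) + (a < c))%N.
  by rewrite /j !count_cat /=; ring.
have hjs : (j <= size (u ++ a :: a :: v))%N by exact: count_size.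
have hps : (p <= size (u ++ v))%N.
  by case/andP: hp => _ /leq_trans; apply; exact: count_size.
rewrite size_cat /= in hs hjs; rewrite size_cat in hps.
(* A letter c <= a is taken from an index at most p of the sorted word, so its removal had shifted p
   by one; a larger letter is taken from beyond p+1 and leaves p unchanged. *)
have [hca|hca] := leqP c a.
  exists p.+1; first by case: (c < a)%N; case/andP: hp; lia.
  have hjp : (j <= p)%N.
    rewrite hj (leq_gtF hca) !addn0; case/andP: hp => hp _; apply: leq_trans hp.
    by apply: sub_count => y /=; lia.
  by rewrite T_up_inv_far ?addSnnS //; lia.
exists p; first by move: hp; lia.
have hjp : (p.+1 < j)%N.
  rewrite hj hca addn1 addn1 !ltnS; case/andP: hp => _ hp; apply: leq_trans hp _.
  by apply: sub_count => y /=; lia.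
by rewrite addSnnS T_up_inv //; lia.
Qed.

Definition heckeE (s : seq nat) : V := Eop 0 s (monom 0 (sort leq s)).

Lemma heckeE_desc u a b v : (b < a)%N -> (size (u ++ a :: b :: v) <= N)%N ->
  T (size u) (heckeE (u ++ a :: b :: v)) = heckeE (u ++ b :: a :: v).
Proof.
move=> hab hs; rewrite /heckeE.
have -> : sort leq (u ++ b :: a :: v) = sort leq (u ++ a :: b :: v).
  apply/perm_sortP; [exact: leq_total|exact: leq_trans|exact: anti_leq|].
  exact: perm_swap.
by rewrite -[size u]add0n T_Eop_desc // add0n.
Qed.

Lemma heckeE_desc_inv u a b v : (a < b)%N -> (size (u ++ a :: b :: v) <= N)%N ->
  Tinv (size u) (heckeE (u ++ a :: b :: v)) = heckeE (u ++ b :: a :: v).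
Proof.
move=> hab hs; rewrite -(@heckeE_desc u b a v) // ?TK //.
  by rewrite size_cat /= in hs; lia.
by move: hs; rewrite !size_cat.
Qed.

Lemma Eop_Z o s c v : Eop o s (c *: v) = c *: Eop o s v.
Proof.
have dnvZ o' j w : up_inv o' j (c *: w) = c *: up_inv o' j w.
  by elim: j w => //= j IH w; rewrite TinvZ IH.
by elim: s o v => //= a s IH o v; rewrite dnvZ IH.
Qed.

Lemma heckeE_eq u a v : (size (u ++ a :: a :: v) <= N)%N ->
  T (size u) (heckeE (u ++ a :: a :: v)) = q *: heckeE (u ++ a :: a :: v).
Proof.
move=> hs; have [p hp] := @T_Eop_eq 0 u a v (monom 0 (sort leq (u ++ a :: a :: v))) hs.
rewrite add0n /heckeE => ->; rewrite add0n -Eop_Z; congr (Eop _ _ _).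
set s := u ++ a :: a :: v; set t := sort leq s.
have ht : sorted leq t by apply: sort_sorted; exact: leq_total.
have hst : perm_eq t s by rewrite perm_sort.
have hc c : count (fun b => (b < c)%N) t =
    (count (fun b => b < c) (u ++ v) + (a < c) + (a < c))%N.
  by rewrite (seq.permP hst) !count_cat /=; ring.
have hpt : (p.+1 < size t)%N.
  apply: leq_trans (count_size (fun b => (b < a.+1)%N) t).
  by rewrite hc ltnS leqnn !addn1; lia.
have hnth r : (p <= r <= p.+1)%N -> nth 0%N t r = a.
  move=> hr; apply/eqP; rewrite eqn_leq -ltnS.
  rewrite nth_lt_count ?(leq_ltn_trans _ hpt) ?[(a <= _)%N]leqNgt ?nth_lt_count //; try lia.
  by rewrite !hc ltnn ltnS leqnn; lia.
have -> : t = take p t ++ a :: a :: drop p.+2 t.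
  rewrite -{1}(cat_take_drop p t); congr (_ ++ _).
  rewrite (drop_nth 0%N) ?(drop_nth 0%N (n := p.+1)) ?hnth //; lia.
have hsz : size (take p t) = p by rewrite size_take; case: ltnP => //; lia.
rewrite -[X in T X]add0n -{1}hsz T_monom // add0n hsz.
by apply: leq_trans hpt _; rewrite (perm_size hst).
Qed.

Lemma heckeE_sorted s : sorted leq s -> heckeE s = monom 0 s.
Proof.
move=> hs; rewrite /heckeE (sorted_sort leq_trans hs).
elim: s {1}0%N (monom 0 s) hs => //= a s IH o v hs.
have -> : count (fun b => (b < a)%N) s = 0%N.
  apply/eqP; rewrite -leqn0 leqNgt -has_count -all_predC.
  have: all (leq a) s by exact: order_path_min leq_trans hs.
  by apply: sub_all => b /=; rewrite -leqNgt.
by rewrite IH // (path_sorted hs).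
Qed.

(** * The raising operator X_0 T_0 ... T_(N-2) *)

Fixpoint dn (j l : nat) (v : V) : V :=
  if l is l'.+1 then T j (dn j.+1 l' v) else v.

Lemma dn_is_linear j l : linear (dn j l).
Proof. by elim: l j => // l IH j a u v /=; rewrite IH linearP. Qed.
HB.instance Definition _ j l :=
  GRing.isLinear.Build L V V *:%R (dn j l) (dn_is_linear j l).

Lemma dn_cat j k l v : dn j (k + l) v = dn j k (dn (j + k) l v).
Proof. by elim: k j => [|k IH] j /=; rewrite ?addn0 // IH addSnnS. Qed.

Lemma dn_far j l k v : (k.+1 < j)%N -> (j + l < N)%N ->
  dn j l (T k v) = T k (dn j l v).
Proof.
elim: l j => //= l IH j hk hl.
by rewrite IH 1?T_comm //; lia.
Qed.

Lemma dn_T j l i v : (i.+1 < l)%N -> (j + l < N)%N ->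
  dn j l (T (j + i) v) = T (j + i.+1) (dn j l v).
Proof.
elim: l j i => // l IH j [|i] hi hl /=.
  case: l IH hi hl => // l IH _ hl /=.
  by rewrite addn0 addn1 -T_braid ?dn_far //; lia.
by rewrite -addSnnS IH 1?T_comm ?addSnnS //; lia.
Qed.

Definition raise_op (v : V) : V := X 0 (dn 0 N.-1 v).

Lemma raise_op_is_linear : linear raise_op.
Proof. by move=> a u v; rewrite /raise_op !linearP. Qed.
HB.instance Definition _ :=
  GRing.isLinear.Build L V V *:%R raise_op raise_op_is_linear.

(** This makes [raise_op] the rotation of the affine Hecke algebra, and reduces its computation on
    E_alpha to a single order of the letters other than the last. *)
Lemma raise_op_T i v : (i.+2 < N)%N -> raise_op (T i v) = T i.+1 (raise_op v).
Proof.
move=> hi; have := @dn_T 0 N.-1 i v; rewrite !add0n /raise_op => ->; try lia.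
by rewrite T_X_far.
Qed.

(** Iteration of X_o T_o = q T_o^(-1) X_(o+1). *)
Lemma X_dn o j v : (o + j < N)%N -> X o (dn o j v) = q ^+ j *: up_inv o j (X (o + j) v).
Proof.
elim: j o v => [|j IH] o v hj; first by rewrite scale1r addn0.
have hXT w : X o (T o w) = q *: Tinv o (X o.+1 w).
  by rewrite -[LHS](@TK o) ?T_X ?TinvZ //; lia.
rewrite [dn _ _ _]/= hXT IH; last by lia.
rewrite TinvZ -up_inv_recl.
by rewrite scalerA exprS addSnnS.
Qed.

Lemma dn_heckeE u w g v : all (fun b => g < b)%N w ->
  (size (u ++ w ++ g :: v) <= N)%N ->
  dn (size u) (size w) (heckeE (u ++ w ++ g :: v)) = heckeE (u ++ g :: w ++ v).
Proof.
elim: w u => //= b w IH u /andP[hb hw] hs.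
have := IH (rcons u b) hw; rewrite size_rcons !cat_rcons => -> //.
by rewrite heckeE_desc //; move: hs; rewrite !size_cat /= !size_cat /=; lia.
Qed.

Lemma up_inv_heckeE u w g v : all (fun b => b < g)%N w ->
  (size (u ++ w ++ g :: v) <= N)%N ->
  up_inv (size u) (size w) (heckeE (u ++ w ++ g :: v)) = heckeE (u ++ g :: w ++ v).
Proof.
elim: w u => //= b w IH u /andP[hb hw] hs; rewrite -[LHS]/(up_inv _ (size w).+1 _) up_inv_recl.
have := IH (rcons u b) hw; rewrite size_rcons !cat_rcons => -> //.
by rewrite heckeE_desc_inv //; move: hs; rewrite !size_cat /= !size_cat /=; lia.
Qed.

Lemma raise_op_E s g : size s = N.-1 -> (0 < N)%N ->
  raise_op (heckeE (rcons s g)) = q ^+ count (fun b => b <= g)%N s *: heckeE (g.+1 :: s).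
Proof.
move=> hs hN; pose P s' := size s' = N.-1 ->
  raise_op (heckeE (rcons s' g)) = q ^+ count (fun b => b <= g)%N s' *: heckeE (g.+1 :: s').
suff: P s by apply.
have hst : perm_eq (sort leq s) s by rewrite perm_sort.
(* A swap in [s] is effected on one side by a generator or its inverse, and on the other by the same
   one with its index raised; hence [s] may be taken sorted. *)
apply: (perm_swap_ind (P := P) _ hst) => [u a b v hP hsz|].
  have {}hP : raise_op (heckeE (rcons (u ++ a :: b :: v) g)) =
     q ^+ count (fun b => b <= g)%N (u ++ b :: a :: v) *: heckeE (g.+1 :: u ++ a :: b :: v).
    by rewrite hP; [rewrite (seq.permP (perm_swap u a b v))|rewrite -hsz !size_cat].
  move: hsz hP; rewrite -!cats1 -!catA /= size_cat /= => hsz hP.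
  have piTiv i w : (i.+2 < N)%N -> raise_op (Tinv i w) = Tinv i.+1 (raise_op w).
    by move=> hi; rewrite /Tinv linearZ linearB linearZ /= raise_op_T.
  have [hab|hab|hab] := ltngtP a b; last by move: hP; rewrite hab.
    rewrite -heckeE_desc_inv //; last by rewrite size_cat /= size_cat /=; lia.
    rewrite piTiv ?hP; last by lia.
    have := @heckeE_desc_inv (g.+1 :: u) a b v hab; rewrite /= => <-; last first.
      by rewrite size_cat /=; lia.
    by rewrite TinvZ.
  rewrite -heckeE_desc //; last by rewrite size_cat /= size_cat /=; lia.
  rewrite raise_op_T ?hP; last by lia.
  have := @heckeE_desc (g.+1 :: u) a b v hab; rewrite /= => <-; last first.
    by rewrite size_cat /=; lia.
  by rewrite linearZ.
set t := sort leq s => ht.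
have hts : sorted leq t by apply: sort_sorted; exact: leq_total.
(* The letter g first moves left across the letters > g, which gives a sorted word, hence a
   monomial. By [X_dn] the remaining T_0 ... T_(c-1) become inverse generators, at the cost of q^c,
   and these carry g+1 to the front across the letters <= g. *)
pose c := count (fun b => b < g.+1)%N t.
have hc : (c <= size t)%N by exact: count_size.
set S1 := take c t; set S2 := drop c t.
have hS1 : size S1 = c by rewrite size_take; case: ltnP => //; lia.
have hall1 : all (fun b => b < g.+1)%N S1.
  apply/(all_nthP 0%N) => i; rewrite hS1 => hi.
  by rewrite nth_take // nth_lt_count //; lia.
have hall2 : all (fun b => g < b)%N S2.
  apply/(all_nthP 0%N) => i; rewrite size_drop => hi.
  by rewrite nth_drop ltnNge -ltnS nth_lt_count //; lia.
have htS : t = S1 ++ S2 by rewrite cat_take_drop.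
have hS2 : (c + size S2 = N.-1)%N by rewrite -ht htS size_cat hS1.
have hsort h : (g <= h <= g.+1)%N -> sorted leq (S1 ++ h :: S2).
  move=> hh; move: hts; rewrite htS !(sorted_pairwise leq_trans) !pairwise_cat /=.
  case/and3P=> hr h1 h2; rewrite h1 h2 allrel_consr hr !andbT; apply/andP; split.
    by apply: sub_all hall1 => b /=; lia.
  by apply: sub_all hall2 => b /=; lia.
rewrite /raise_op htS -cats1 -catA -hS2 dn_cat add0n -hS1 dn_heckeE //; last first.
  by rewrite !size_cat /=; lia.
rewrite cats0 heckeE_sorted ?hsort ?leqnn ?leqnSn // X_dn; last by lia.
rewrite X_monom -heckeE_sorted ?hsort ?leqnn ?leqnSn //.
have := @up_inv_heckeE [::] S1 g.+1 S2; rewrite /= => -> //; last by rewrite size_cat /=; lia.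
by congr (_ ^+ _ *: _); rewrite -htS hS1.
Qed.

(** The power of q compensates the factor q with which the symmetrizer absorbs each generator on its
    right, so that the order of the letters from position k on does not matter. *)
Definition Ehat (k : nat) (s : seq nat) : V :=
  q ^+ inversions s *: hecke_sym k (N.-1 - k) (heckeE s).

Lemma Ehat_swap k u a b v : (k <= size u)%N -> size (u ++ a :: b :: v) = N ->
  Ehat k (u ++ a :: b :: v) = Ehat k (u ++ b :: a :: v).
Proof.
move=> hk; wlog hab : a b / (b < a)%N => [IH hs|hs].
  have [hab|hab|->//] := ltngtP a b; last exact: IH.
  by rewrite -IH //; rewrite -hs !size_cat.
rewrite /Ehat -(@heckeE_desc u a b v) ?hs // -[X in T X](subnKC hk) hecke_sym_T; [|rewrite -hs size_cat /=; lia..].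
rewrite scalerA -exprSr; congr (_ ^+ _ *: _).
by rewrite !inversions_cat_cons /= hab (leq_gtF (ltnW hab)); lia.
Qed.

Lemma Ehat_perm s t t' : perm_eq t t' -> size (s ++ t) = N ->
  Ehat (size s) (s ++ t) = Ehat (size s) (s ++ t').
Proof.
move=> ht hN; pose P r := size (s ++ r) = N /\ Ehat (size s) (s ++ t) = Ehat (size s) (s ++ r).
suff [] : P t' by [].
apply: (perm_swap_ind (P := P) _ ht) => // u a b v [hs h]; split.
  by rewrite -hs !size_cat.
by rewrite h catA Ehat_swap -?catA // size_cat leq_addr.
Qed.

Lemma Ehat_forget k s : (k < N)%N ->
  symC k (N.-1 - k) (Ehat k.+1 s) = Ehat k s.
Proof.
move=> hk; rewrite /Ehat linearZ /=; congr (_ *: _).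
case hl : (N.-1 - k)%N => [|l]; last by have -> : (N.-1 - k.+1 = l)%N by lia.
have -> : (N.-1 - k.+1 = 0)%N by lia.
by rewrite /symC big_ord_recl big_ord0 addr0.
Qed.

Lemma up_heckeE u g w : all (fun b => b <= g)%N w -> (size (u ++ g :: w) <= N)%N ->
  up (size u) (size w) (heckeE (u ++ g :: w)) =
  q ^+ count_mem g w *: heckeE (rcons (u ++ w) g).
Proof.
elim: w u => [|b w IH] u; first by rewrite /= cats0 cats1 scale1r.
move=> /andP[hb hw] hs; rewrite [size (b :: w)]/= up_recl.
have := IH (rcons u b) hw; rewrite size_rcons !cat_rcons => IHu.
have [hbg|hbg] := ltnP b g.
  rewrite heckeE_desc //= ltn_eqF // add0n IHu //.
  by move: hs; rewrite !size_cat.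
have {hb hbg} hbg : b = g by apply/eqP; rewrite eqn_leq hb.
by rewrite hbg in IHu hs *; rewrite heckeE_eq // linearZ /= IHu // scalerA eqxx exprS.
Qed.

Lemma dn_hecke_sym k l v : (k + l < N)%N -> dn k l (hecke_sym k l v) = q ^+ l *: hecke_sym k l v.
Proof.
move=> hN; suff h j d : (k <= j)%N -> (j + d <= k + l)%N ->
    dn j d (hecke_sym k l v) = q ^+ d *: hecke_sym k l v by apply: h.
elim: d j => [|d IH] j hj hd /=; first by rewrite scale1r.
rewrite IH //; [|lia|lia].
by rewrite linearZ /= -(subnKC hj) T_hecke_sym ?scalerA ?exprSr //; lia.
Qed.

(** The missing generators T_k, ..., T_(N-2) act on the symmetrized vector by q, so X_0 T_0 ...
    T_(k-1) may be completed to [raise_op]. By [hecke_sym_factor] each letter of [t] in turn is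
    carried to the last place, where [raise_op] raises it. In decreasing order a moving letter meets
    only letters at most equal to it, as [up_heckeE] requires. *)
Lemma Ehat_add_sorted s t : size (s ++ t) = N -> (size s < N)%N -> sorted geq t ->
  X 0 (dn 0 (size s) (Ehat (size s) (s ++ t))) =
  \sum_(p < size t) (q ^+ count (fun b => nth 0 t p < b)%N s *
     q^-1 ^+ count_mem (nth 0%N t p) (take p t)) *:
     Ehat (size s).+1 ((nth 0%N t p).+1 :: s ++ take p t ++ drop p.+1 t).
Proof.
move=> hN hs ht; set k := size s in hs *; set l := (N.-1 - k)%N.
have hkl : (k + l = N.-1)%N by rewrite /l; lia.
rewrite {1}/Ehat -/l.
have -> : X 0 (dn 0 k (q ^+ inversions (s ++ t) *: hecke_sym k l (heckeE (s ++ t)))) =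
   (q ^+ inversions (s ++ t) * q ^- l) *: raise_op (hecke_sym k l (heckeE (s ++ t))).
  rewrite /raise_op -{1}hkl dn_cat add0n dn_hecke_sym; last by lia.
  rewrite !linearZ /= !scalerA.
  by rewrite mulrC mulfVK // expf_neq0.
have -> : hecke_sym k l (heckeE (s ++ t)) = hecke_sym k l.-1 (symD k l (heckeE (s ++ t))).
  case: l hkl => [|l] hkl; last by apply: hecke_sym_factor; lia.
  by rewrite /= /symD big_ord_recl big_ord0 addr0 addn0.
have -> w : raise_op (hecke_sym k l.-1 w) = hecke_sym k.+1 l.-1 (raise_op w).
  apply: hecke_sym_intertwine => i u hi.
  by rewrite addSn -raise_op_T //; lia.
have hlt : l.+1 = size t by move: hN; rewrite size_cat -/k; lia.
rewrite /symD hlt !linear_sum; apply: eq_bigr => p _.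
have hp := ltn_ord p.
set g := nth 0%N t p; set u := take p t; set v := drop p.+1 t.
have htp : t = u ++ g :: v by rewrite -{1}(cat_take_drop p t) (drop_nth 0%N).
have hsu : size u = p by rewrite size_take hp.
have hall : all (fun b => b <= g)%N v.
  have /(order_path_min _) : path geq g v.
    by move: ht; rewrite htp => /cat_sorted2[].
  by apply=> x y z; rewrite /geq /= => h1 h2; apply: leq_trans h1.
have hallu : all (fun b => g <= b)%N u.
  move: ht; rewrite htp sorted_pairwise; last first.
    by move=> x y z; rewrite /geq /= => h1 h2; apply: leq_trans h1.
  by rewrite pairwise_cat allrel_consr => /and3P[/andP[]].
have hv : size v = (l - p)%N by rewrite size_drop; lia.
have hup : up (k + p) (l - p) (heckeE (s ++ t)) =
    q ^+ count_mem g v *: heckeE (rcons ((s ++ u) ++ v) g).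
  rewrite -hv -hsu -size_cat -up_heckeE -?catA -?htp //.
  by rewrite hN.
rewrite hup -[LHS]/(_ *: hecke_sym k.+1 l.-1 (raise_op (_ *: heckeE _))).
rewrite [raise_op _]linearZ /= raise_op_E; [|rewrite !size_cat hsu hv -/k; lia|lia].
rewrite /Ehat subnS -/l !linearZ /= !scalerA -!catA.
congr (_ *: _).
have hc1 : (count (fun b => b < g) v + count_mem g v = size v)%N.
  rewrite -(count_predC (fun b => b < g)%N); congr addn.
  by apply: eq_in_count => b /(allP hall) /=; lia.
have hc2 : (count (fun b => g < b) u + count_mem g u = size u)%N.
  rewrite -(count_predC (fun b => g < b)%N); congr addn.
  by apply: eq_in_count => b /(allP hallu) /=; lia.
(* Balance of the exponents of q, with the negative ones moved across; l is the number of letters in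
   [u] and [v], split by comparison with g. *)
have hinv : (inversions (s ++ t) + count_mem g v + count (fun b => b <= g) ((s ++ u) ++ v) +
  count_mem g u = count (fun b => g < b) s + (inversions (g.+1 :: s ++ u ++ v)) + l)%N.
  rewrite htp catA inversions_cat_cons /= -!catA count_cat.
  have -> : count (fun b => b < g.+1)%N (s ++ u ++ v) = count (fun b => b <= g)%N (s ++ u ++ v) by [].
  have hpl : (p <= l)%N by lia.
  have -> : l = (count (fun b => b < g) v + count_mem g v +
                 (count (fun b => g < b) u + count_mem g u))%N.
    by rewrite hc1 hc2 hsu hv subnK.
  by ring.
apply: (mulIf (x := q ^+ l * q ^+ count_mem g u)).
  by rewrite mulf_neq0 ?expf_neq0.
rewrite -catA in hinv.
rewrite [RHS](_ : _ = q ^+ (count (fun b => g < b)%N s + inversions (g.+1 :: s ++ u ++ v) + l)); last first.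
  rewrite !exprD exprVn; set x := _ ^+ count_mem _ _.
  have hx : x != 0 by rewrite expf_neq0.
  by field.
rewrite -hinv !exprD; set x := q ^+ l.
have hx : x != 0 by rewrite expf_neq0.
by field.
Qed.

(** The q-number [m] at 1/q. *)
Definition qVint (m : nat) : L := \sum_(r < m) q^-1 ^+ r.

Lemma Ehat_add B s t : size (s ++ t) = N -> (size s < N)%N ->
  all (fun b => b < B)%N t ->
  X 0 (dn 0 (size s) (Ehat (size s) (s ++ t))) =
  \sum_(g < B) (q ^+ count (fun b => g < b)%N s * qVint (count_mem (g : nat) t)) *:
     Ehat (size s).+1 (g.+1 :: s ++ rem (g : nat) t).
Proof.
move=> hN hs hB; pose t' := sort geq t.
have ht : perm_eq t t' by rewrite perm_sym perm_sort.
have ht' : sorted geq t' by apply: sort_sorted => x y; exact: leq_total.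
have hN' : size (s ++ t') = N by rewrite size_cat -(perm_size ht) -size_cat.
rewrite (Ehat_perm ht) // Ehat_add_sorted //.
pose F g r : V := (q ^+ count (fun b => g < b)%N s * q^-1 ^+ r) *:
  Ehat (size s).+1 (g.+1 :: s ++ rem g t').
transitivity (\sum_(p < size t') F (nth 0%N t' p) (count_mem (nth 0%N t' p) (take p t'))).
  apply: eq_bigr => p _; rewrite /F; congr (_ *: _).
  have hp := ltn_ord p; set g := nth 0%N t' p.
  apply: (@Ehat_perm (g.+1 :: s)).
    rewrite -(perm_cons g) -(permPr (perm_to_rem _)) ?mem_nth //.
    by rewrite -cat1s perm_catCA /= -drop_nth // cat_take_drop.
  by rewrite -hN' /= !size_cat size_take size_drop hp; lia.
rewrite (sum_by_value F (B := B)); last first.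
  by apply/allP => b; rewrite -(perm_mem ht) => /(allP hB).
apply: eq_bigr => g _; rewrite /F -scaler_suml -mulr_sumr.
rewrite -(seq.permP ht) -/(qVint _).
have [hg|hg] := boolP ((g : nat) \in t).
  congr (_ *: _); apply/esym/(@Ehat_perm (g.+1 :: s)).
    by rewrite -(perm_cons (g : nat)) -!(permPr (perm_to_rem _)) -?(perm_mem ht) //
      -(permPl (perm_to_rem hg)).
  by rewrite -hN /= !size_cat size_rem //; case: (t) hg => //= *; rewrite addnS.
by rewrite (count_memPn hg) /qVint big_ord0 mulr0 !scale0r.
Qed.

(** * Windows and generating functions of colorings *)

Variable kf : nat -> nat.
Hypothesis kf0 : kf 0 = 0%N.
Hypothesis kfS : forall i, (kf i.+1 <= (kf i).+1)%N.

Lemma kf_le i : (kf i <= i)%N.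
Proof. by elim: i => [|i IH]; rewrite ?kf0 // (leq_trans (kfS i)). Qed.

(** A new vertex enlarges the window by one; then the oldest vertices leave one at a time until
    [kf i.+1] remain. The second argument of [Q] records the sizes in between. *)
Lemma window_ind (Q : nat -> nat -> Prop) : Q 0%N 0%N ->
  (forall i, Q i (kf i) -> Q i.+1 (kf i).+1) ->
  (forall i k, (k < i)%N -> Q i k.+1 -> Q i k) ->
  forall i, Q i (kf i).
Proof.
move=> h0 hadd hforget; elim=> [|i /hadd IH]; first by rewrite kf0.
have := kfS i; have : ((kf i).+1 <= i.+1)%N by rewrite ltnS kf_le.
elim: (kf i).+1 IH => [h _|k IHk h hk]; first by rewrite leqn0 => /eqP->.
rewrite leq_eqVlt => /orP[/eqP->//|]; rewrite ltnS => hk'.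
by apply: IHk hk'; [apply: hforget h|exact: ltnW].
Qed.

(* A word lists the colors (resp. rows) of the vertices (resp. entries) from
   the most recent one; its first [kf i] letters are those of the current
   window. *)
Fixpoint color_weight (s : seq nat) : V :=
  if s is c :: s' then
    let w := take (kf (size s')) s' in
    if c \in w then 0 else q ^+ count (fun b => b < c)%N w *: X c (color_weight s')
  else v1.

Definition color_gf (i k : nat) (c : seq nat) : V :=
  \sum_(s <- words N i | take k s == c) color_weight s.

Lemma color_gf_add i c0 c : (c0 < N)%N -> size c = kf i ->
  color_gf i.+1 (kf i).+1 (c0 :: c) =
  if c0 \in c then 0 else q ^+ count (fun b => b < c0)%N c *: X c0 (color_gf i (kf i) c).
Proof.
move=> hc0 hc; rewrite /color_gf big_mkcond sum_words.
transitivity (\sum_(s <- words N i) if take (kf i) s == c then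
   if c0 \in c then 0 else q ^+ count (fun b => b < c0)%N c *: X c0 (color_weight s) else 0).
  apply: eq_big_seq => s; rewrite mem_words => /andP[/eqP hs _].
  rewrite (bigD1 (Ordinal hc0)) //= big1 ?addr0.
    by rewrite eqseq_cons eqxx hs; case: eqP => // ->.
  by move=> g; rewrite -val_eqE eqseq_cons /= => /negPf->.
rewrite -big_mkcond /=; case: ifP => _; first by rewrite big1.
by rewrite linear_sum scaler_sumr.
Qed.

Lemma color_gf_forget i k c : (k < i)%N -> size c = k ->
  color_gf i k c = \sum_(c' < N) color_gf i k.+1 (rcons c c').
Proof.
move=> hk hc; rewrite /color_gf [RHS](exchange_big_dep xpredT) //= big_mkcond.
apply: eq_big_seq => s; rewrite mem_words => /andP[/eqP hs hall].
have hn : (nth 0 s k < N)%N by apply: (allP hall); rewrite mem_nth ?hs.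
have ht : take k.+1 s = rcons (take k s) (nth 0%N s k).
  by rewrite (take_nth 0%N) ?hs.
rewrite ht; case: eqP => h.
  by rewrite h (big_pred1 (Ordinal hn)) // => c' /=; rewrite eqseq_rcons eqxx -val_eqE eq_sym.
by rewrite big_pred0 // => c'; rewrite eqseq_rcons; case: eqP.
Qed.

(* Two colors a and a+1 are exchanged by T_a, provided that a+1, if it occurs
   in the window, is the color of an older vertex than a. *)
Definition exchange (k : nat) (F : seq nat -> V) : Prop :=
  forall c, size c = k -> all (fun x => x < N)%N c ->
  (~~ uniq c -> F c = 0) /\
  (forall a, (a.+1 < N)%N -> uniq c ->
     (a \notin c -> a.+1 \notin c -> T a (F c) = q *: F c) /\
     (a \in c -> (index a c < index a.+1 c)%N -> T a (F c) = F (map (swap_succ a) c))).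

(** If a and a+1 are both absent, the summands where the forgotten vertex has color a or a+1 are v
    and T_a v, and v + T_a v is an eigenvector by the quadratic relation. If a is present, the sum
    is reindexed by the exchange of a and a+1; the forgotten vertex, being the oldest, does not
    disturb the order condition. *)
Lemma exchange_forget k F F' : exchange k.+1 F ->
  (forall c, size c = k -> all (fun x => x < N)%N c ->
     F' c = \sum_(c' < N) F (rcons c c')) ->
  exchange k F'.
Proof.
move=> hF hF' c hc hall.
have hs c' : size (rcons c c') = k.+1 by rewrite size_rcons hc.
have ha (c' : 'I_N) : all (fun x => x < N)%N (rcons c c') by rewrite all_rcons ltn_ord.
split=> [hu|a haN hu].
  rewrite hF' // big1 // => c' _; apply: (hF _ (hs _) (ha _)).1.
  by rewrite rcons_uniq negb_and hu orbT.
split=> [h1 h2|h1 h2].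
  rewrite hF' // linear_sum scaler_sumr.
  rewrite (bigD1 (Ordinal haN)) //= (bigD1 (Ordinal (ltnW haN))) /=; last first.
    by rewrite -val_eqE /=; lia.
  rewrite [in RHS](bigD1 (Ordinal haN)) //= [in RHS](bigD1 (Ordinal (ltnW haN))) /=; last first.
    by rewrite -val_eqE /=; lia.
  rewrite !addrA; congr (_ + _); last first.
    apply: eq_bigr => c' /andP[]; rewrite -!val_eqE /= => n1 n2.
    have [hcc|hcc] := boolP ((c' : nat) \in c).
      rewrite (hF _ (hs _) (ha _)).1 ?linear0 ?scaler0 //.
      by rewrite rcons_uniq hcc.
    have hu' : uniq (rcons c c') by rewrite rcons_uniq hcc.
    apply: ((hF _ (hs _) (ha _)).2 a haN hu').1.
      by rewrite mem_rcons inE negb_or h1 eq_sym n2.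
    by rewrite mem_rcons inE negb_or h2 eq_sym n1.
  have -> : F (rcons c a.+1) = T a (F (rcons c a)).
    have hu' : uniq (rcons c a) by rewrite rcons_uniq h1.
    rewrite ((hF _ (hs a) (ha (Ordinal (ltnW haN)))).2 a haN hu').2.
    - by rewrite map_rcons map_sw_id // /swap_succ eqxx.
    - by rewrite mem_rcons mem_head.
    - rewrite -!cats1 !index_cat (negPf h1) (negPf h2) /= eqxx.
      by rewrite eqn_leq ltnn andbF addn0 addn1.
  rewrite T_quad // scalerBl scale1r [RHS]addrC; set A := T a _; set B := q *: F _.
  by rewrite addrAC subrK addrC.
have h1' : map (swap_succ a) c = map (swap_succ a) c by [].
rewrite hF' // hF' ?size_map //; last first.
  by rewrite all_map; apply: sub_all hall => x /=; exact: swap_succ_lt.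
rewrite linear_sum.
pose swo (c' : 'I_N) := Ordinal (swap_succ_lt haN (ltn_ord c')).
have hswo : involutive swo by move=> x; apply: val_inj; rewrite /= swap_succK.
rewrite [RHS](reindex_inj (inv_inj hswo)); apply: eq_bigr => c' _ /=.
rewrite -map_rcons; have [hcc|hcc] := boolP ((c' : nat) \in c).
  rewrite (hF _ (hs _) (ha _)).1 ?linear0; last by rewrite rcons_uniq hcc.
  rewrite (hF _ _ _).1 ?size_map //.
    by rewrite all_map; apply: sub_all (ha c') => x /=; exact: swap_succ_lt.
  by rewrite (map_inj_uniq (inv_inj (swap_succK a))) rcons_uniq hcc.
have hu' : uniq (rcons c c') by rewrite rcons_uniq hcc.
apply: ((hF _ (hs _) (ha _)).2 a haN hu').2.
  by rewrite mem_rcons inE h1 orbT.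
rewrite -cats1 !index_cat h1; case: ifP => h3 //.
by apply: leq_trans (leq_addr _ _); rewrite index_mem.
Qed.

(** Only a new color a needs more than commutation. If a+1 is in the window, F is T_a of the
    exchanged value, and T_a X_a T_a = q X_(a+1) supplies the q of one more ascent. Otherwise F is
    an eigenvector of T_a, and the same relation applies. *)
Lemma exchange_add k F F' : exchange k F ->
  (forall c0 c, (c0 < N)%N -> size c = k ->
     F' (c0 :: c) = if c0 \in c then 0
       else q ^+ count (fun b => b < c0)%N c *: X c0 (F c)) ->
  exchange k.+1 F'.
Proof.
move=> hF hF' [//|c0 c] [hc] /= /andP[hc0 hall].
rewrite hF' //; split=> [|a haN /andP[hcc hu]].
  case: (c0 \in c) => //= hu; rewrite (hF _ hc hall).1 //.
  by rewrite linear0 scaler0.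
have [h0 hTa] := hF _ hc hall; have [hT1 hT2] := hTa a haN hu.
rewrite (negPf hcc) !inE !negb_or; split.
  case/andP=> n1 n2 /andP[n3 n4].
  by rewrite linearZ /= T_X_far ?hT1 ?linearZ //= 1?eq_sym // scalerA mulrC scalerA.
have [e|n0] /= := eqVneq c0 a.
  move: hcc hc0 hT1 hT2; rewrite e => hcc ha hT1 hT2.
  move=> _ _; rewrite /swap_succ eqxx -/(swap_succ a).
  rewrite hF' ?size_map // linearZ /=.
  have hin : a.+1 \notin map (swap_succ a) c.
    apply/mapP => -[x hx]; rewrite /swap_succ; case: eqP => [ex _|_].
      by rewrite -ex hx in hcc.
    by case: eqP; lia.
  rewrite (negPf hin).
  have hcnt : count (fun b => b < a.+1)%N (map (swap_succ a) c) =
     (count (fun b => b < a) c + count_mem a.+1 c)%N.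
    rewrite count_map -[RHS]addnC -count_predUI addnC.
    rewrite [X in (X + _)%N](eq_count (a2 := pred0)) ?count_pred0 ?add0n.
      apply: eq_in_count => x hx /=; rewrite /swap_succ.
      have [ex|n] := eqVneq x a; first by rewrite -ex hx in hcc.
      case: eqVneq => [_|n']; first by rewrite ltnSn ?orbT.
      by rewrite ?orbF ltnS leq_eqVlt (negPf n).
    by move=> x /=; lia.
  rewrite hcnt count_uniq_mem //.
  have [ha1|ha1] := boolP (a.+1 \in c).
    have hu1 : uniq (map (swap_succ a) c) by rewrite (map_inj_uniq (inv_inj (swap_succK a))).
    have hall1 : all (fun x => x < N)%N (map (swap_succ a) c).
      by rewrite all_map; apply: sub_all hall => x /=; exact: swap_succ_lt.
    have hin1 : a \in map (swap_succ a) c.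
      by apply/mapP; exists a.+1 => //; rewrite /swap_succ eqn_leq ltnn eqxx.
    have := ((hF (map (swap_succ a) c) _ hall1).2 a haN hu1).2 hin1.
    rewrite size_map => /(_ hc); rewrite -map_comp (eq_map (swap_succK a)) map_id.
    rewrite (memNindex hin) index_mem => /(_ hin1) <-.
    by rewrite T_X // scalerA addn1 exprSr.
  rewrite addn0 map_sw_id //; congr (_ *: _).
  have := T_X (F c) haN; rewrite hT1 // !linearZ /= => /(congr1 (fun v => q^-1 *: v)).
  by rewrite !scalerK.
(* A new color a+1 precedes a in the window, against the assumption on the order. *)
have [//|n1] /= := eqVneq c0 a.+1.
rewrite ltnS => h1 h2.
rewrite {1}/swap_succ (negPf n0) (negPf n1) hF' ?size_map //.
have -> : (c0 \in map (swap_succ a) c) = (c0 \in c).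
  have e : c0 = swap_succ a c0 by rewrite /swap_succ (negPf n0) (negPf n1).
  by rewrite {1}e (mem_map (inv_inj (swap_succK a))).
rewrite (negPf hcc) linearZ /= T_X_far // hT2 //; congr (_ ^+ _ *: _).
rewrite count_map; apply: eq_count => x /=; rewrite /swap_succ.
move/eqP: n0 => n0; move/eqP: n1 => n1.
have [->|_] := eqVneq x a; first by apply/idP/idP; lia.
by have [->|_] := eqVneq x a.+1; [apply/idP/idP; lia|].
Qed.

Lemma color_gf_exchange i : exchange (kf i) (color_gf i (kf i)).
Proof.
apply: (window_ind (Q := fun i k => exchange k (color_gf i k))) => {i} [|i h|i k hk h].
- move=> [|//] _ _; split=> // a haN _; split=> // _ _.
  by rewrite /color_gf /= big_cons big_nil /= addr0 T_v1.
- apply: exchange_add h _ => c0 c; exact: color_gf_add.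
- apply: exchange_forget h _ => c hc _; exact: color_gf_forget.
Qed.

Lemma exchange_up k F d : exchange k.+1 F -> (k + d < N)%N ->
  F (rcons (iota 0 k) (k + d)%N) = up k d (F (rcons (iota 0 k) k)).
Proof.
move=> hF; elim: d => [|d IH] hd; first by rewrite addn0.
have hk : (k + d)%N \notin iota 0 k by rewrite mem_iota; lia.
have hk1 : (k + d).+1 \notin iota 0 k by rewrite mem_iota; lia.
rewrite /= -IH; last by lia.
have hs : size (rcons (iota 0 k) (k + d)%N) = k.+1 by rewrite size_rcons size_iota.
have ha : all (fun x => x < N)%N (rcons (iota 0 k) (k + d)%N).
  rewrite all_rcons; apply/andP; split; first by lia.
  by apply/allP => x; rewrite mem_iota; lia.
have hu : uniq (rcons (iota 0 k) (k + d)%N) by rewrite rcons_uniq hk iota_uniq.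
have hd1 : ((k + d).+1 < N)%N by lia.
rewrite ((hF _ hs ha).2 _ hd1 hu).2.
- by rewrite map_rcons map_sw_id // /swap_succ eqxx addnS.
- by rewrite mem_rcons mem_head.
- rewrite -cats1 !index_cat (negPf hk) (negPf hk1) /= eqxx.

  by rewrite (ltn_eqF (ltnSn _)) /=; lia.
Qed.

(** The colors rise one by one, the largest first, so that the color a+1 to be taken is always
    absent. The window 1, ..., k is the one left to the older vertices when a new vertex takes the
    color 0. *)
Lemma exchange_dn k F : exchange k F -> (k < N)%N ->
  F (iota 1 k) = dn 0 k (F (iota 0 k)).
Proof.
move=> hF hk; suff h j : (j <= k)%N ->
    dn 0 j (F (iota 0 j ++ iota j.+1 (k - j))) = F (iota 1 k).
  by rewrite -(h k) // subnn cats0.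
elim: j => [|j IH] hj; first by rewrite subn0.
rewrite -addn1 dn_cat add0n /= addn1 -IH; last by lia.
have -> : (k - j = (k - j.+1).+1)%N by lia.
congr (dn _ _ _); set c := iota 0 j.+1 ++ _.
have hc : c = iota 0 j ++ j :: iota j.+2 (k - j.+1).
  by rewrite /c -addn1 iotaD -catA add0n.
have h1 : j \notin iota 0 j by rewrite mem_iota; lia.
have h2 : j \notin iota j.+2 (k - j.+1) by rewrite mem_iota; lia.
have h3 : j.+1 \notin iota 0 j by rewrite mem_iota; lia.
have h4 : j.+1 \notin iota j.+2 (k - j.+1) by rewrite mem_iota; lia.
have hs : size c = k by rewrite hc size_cat /= !size_iota; lia.
have ha : all (fun x => x < N)%N c.
  by apply/allP => x; rewrite hc mem_cat inE !mem_iota => h; lia.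
have hu : uniq c.
  rewrite hc cat_uniq /= !iota_uniq h2 !andbT /= negb_or h1 /=.
  by apply/hasPn => x; rewrite /= !mem_iota; lia.
have hjN : (j.+1 < N)%N by lia.
rewrite ((hF _ hs ha).2 _ hjN hu).2.
- by rewrite hc map_cat /= !map_sw_id // /swap_succ eqxx.
- by rewrite hc mem_cat mem_head orbT.
- rewrite hc !index_cat (negPf h1) (negPf h3) /= eqxx.
  by rewrite (ltn_eqF (ltnSn _)) /=; lia.
Qed.

(** There is one column per variable, hence N empty columns at the start. A column of height g > 0
    is made by an entry in row g-1, available only after that entry has left the window. *)
Definition supply (k : nat) (s : seq nat) (g : nat) : nat :=
  if g is g'.+1 then count_mem g' (drop k s) else N.

(* The number of columns of height g whose top entry is not in the window, for
   the tableau whose entries lie successively in the rows s (most recent entry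
   first): an entry in row g - 1 makes a column of height g, one in row g
   destroys it. *)
Definition nfree_heights (k : nat) (s : seq nat) (g : nat) : nat :=
  (supply k s g - count_mem g s)%N.

Definition free_heights (k : nat) (s : seq nat) : seq nat :=
  flatten [seq nseq (nfree_heights k s g) g | g <- iota 0 (size s).+1].

Fixpoint word_weight (s : seq nat) : L :=
  if s is g :: s' then
    let k := kf (size s') in
    word_weight s' * (q ^+ count (fun b => g < b)%N (map S (take k s')) * qVint (nfree_heights k s' g))
  else 1.

(** [tight_count] makes the truncated subtraction in [nfree_heights] exact; [tight_size] splits the
    N columns into the k whose top entry is in the window and the free ones. *)
Record tableau_word (k : nat) (s : seq nat) : Prop := Tight {
  tight_le : (k <= size s)%N;
  tight_row : all (fun r => r < size s)%N s;
  tight_count : forall g, (count_mem g s <= supply k s g)%N;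
  tight_size : (k + size (free_heights k s))%N = N }.

Lemma count_free k s g : all (fun r => r < size s)%N s ->
  count_mem g (free_heights k s) = nfree_heights k s g.
Proof.
move=> hs; rewrite count_blocks ltnS; case: leqP => // hg.
rewrite /nfree_heights; case: g hg => // g hg /=.
rewrite (count_memPn _) ?sub0n //; apply/negP => /mem_drop /(allP hs) /=.
by rewrite ltnNge -ltnS hg.
Qed.

Lemma tableau_word0 : tableau_word 0 [::].
Proof. by split=> //=; rewrite /free_heights /= cats0 size_nseq /nfree_heights subn0. Qed.

Lemma tableau_word_add k s g : tableau_word k s -> (0 < nfree_heights k s g)%N ->
  perm_eq (free_heights k.+1 (g :: s)) (rem g (free_heights k s)) /\ tableau_word k.+1 (g :: s).
Proof.
case=> h1 h2 h3 h4 hg.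
have hgin : g \in free_heights k s by rewrite -has_pred1 has_count count_free.
have hrow : all (fun r => r < size (g :: s))%N (g :: s).
  apply/andP; split; last by apply: sub_all h2 => r /=; exact: ltnW.
  case: g hg {hgin} => // g; rewrite /nfree_heights /= => hg.
  have /mem_drop /(allP h2) : g \in drop k s by rewrite -has_pred1 has_count (leq_trans hg) ?leq_subr.
  by rewrite ltnS.
have hp : perm_eq (free_heights k.+1 (g :: s)) (rem g (free_heights k s)).
  apply/allP => h _ /=; rewrite count_free // count_rem count_free // hgin /=.
  rewrite /nfree_heights; have -> : supply k.+1 (g :: s) h = supply k s h by [].
  by rewrite /= addnC subnDA.
split=> //; split=> //.
- move=> h; have -> : supply k.+1 (g :: s) h = supply k s h by [].
  have := h3 h; rewrite /= eq_sym; have [->|//] := eqVneq h g.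
  by move=> _; rewrite add1n -subn_gt0.
- rewrite (perm_size hp) size_rem // -h4.
  by move: hgin; case: (free_heights k s) => //= *; rewrite addSnnS.
Qed.

Lemma tableau_word_forget k s : tableau_word k.+1 s ->
  perm_eq (free_heights k s) ((nth 0%N s k).+1 :: free_heights k.+1 s) /\ tableau_word k s.
Proof.
case=> h1 h2 h3 h4.
have hb g : supply k s g = ((g == (nth 0%N s k).+1) + supply k.+1 s g)%N.
  by case: g => [|g] //=; rewrite (drop_nth 0%N) //= eqSS eq_sym.
have hp : perm_eq (free_heights k s) ((nth 0%N s k).+1 :: free_heights k.+1 s).
  apply/allP => g _ /=; rewrite !count_free // /nfree_heights hb.
  by rewrite [g == _]eq_sym addnBA.
split=> //; split=> //; first exact: ltnW.
  by move=> g; rewrite hb (leq_trans (h3 g)) ?leq_addl.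
by rewrite (perm_size hp) /= -addSnnS.
Qed.

(** [N]_q!, the eigenvalue of the full symmetrizer on [v1]. *)
Definition qfact : L := \prod_(d < N) \sum_(r < d.+1) q ^+ r.

Lemma hecke_sym_eigen (f : {linear V -> L^o}) j l v : (j + l < N)%N ->
  (forall i w, (j <= i < j + l)%N -> f (T i w) = q * f w) ->
  f (hecke_sym j l v) = (\prod_(d < l.+1) \sum_(r < d.+1) q ^+ r) * f v.
Proof.
elim: l j v => [|l IH] j v hl hf.
  by rewrite big_ord_recl big_ord0 mulr1 big_ord_recl big_ord0 addr0 mul1r.
rewrite [in RHS]big_ord_recr /= mulrAC -(IH j.+1); [|by lia|by move=> i w hi; apply: hf; lia].
rewrite /symC linear_sum mulrC mulr_suml; apply: eq_bigr => c _.
elim: (c : nat) (ltn_ord c) => [|d IHd] hd; first by rewrite mul1r.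
by rewrite /= hf ?IHd ?exprS ?mulrA //; lia.
Qed.

Lemma hecke_sym_v1 j l : (j + l < N)%N ->
  hecke_sym j l v1 = (\prod_(d < l.+1) \sum_(r < d.+1) q ^+ r) *: v1.
Proof.
elim: l j => [|l IH] j hl.
  by rewrite big_ord_recl big_ord0 mulr1 big_ord_recl big_ord0 addr0 scale1r.
rewrite /= IH ?linearZ; last by lia.
rewrite [in RHS]big_ord_recr /= -scalerA; congr (_ *: _).
rewrite /symC scaler_suml; apply: eq_bigr => c _.
elim: (c : nat) (ltn_ord c) => [|d IHd] hd; first by rewrite scale1r.
by rewrite /= IHd ?linearZ /= ?T_v1 ?scalerA ?exprSr //; lia.
Qed.

(** The factor [qfact] comes from the start: the empty coloring gives [v1], while [Ehat] of N zeros
    is the symmetrization of [v1]. Rows are smaller than the number of entries, so an alphabet of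
    size B >= i misses none. *)
Lemma color_gf_expansion B i : (0 < N)%N -> (i <= B)%N -> (kf i <= N)%N ->
  (forall s, s \in words B i -> word_weight s = 0 \/ tableau_word (kf i) s) /\
  qfact *: color_gf i (kf i) (iota 0 (kf i)) =
  \sum_(s <- words B i) word_weight s *: Ehat (kf i) (map S (take (kf i) s) ++ free_heights (kf i) s).
Proof.
move=> hN.
pose Q i k := (i <= B)%N -> [/\ exchange k (color_gf i k),
  (forall s, s \in words B i -> word_weight s = 0 \/ tableau_word k s) &
  (k <= N)%N -> qfact *: color_gf i k (iota 0 k) =
    \sum_(s <- words B i) word_weight s *: Ehat k (map S (take k s) ++ free_heights k s)].
suff hQ : Q i (kf i) by move=> hi hk; have [_ h1 h2] := hQ hi; split=> //; exact: h2.
apply: window_ind => {i} [_|i IH hi|i k hk IH hi].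
- split=> [|s|_].
  + by have := @color_gf_exchange 0%N; rewrite kf0.
  + by rewrite inE => /eqP->; right; exact: tableau_word0.
  rewrite /color_gf !big_cons !big_nil /= !addr0 scale1r /free_heights /= cats0 /nfree_heights subn0.
  have hz : sorted leq (nseq N 0%N).
    by case: (N) => //= m; elim: m.
  rewrite /Ehat inv_sorted // scale1r subn0 heckeE_sorted //.
  have hX m j : monom j (nseq m 0%N) = v1 by elim: m j => //= m IH j; rewrite IH.
  by rewrite hX hecke_sym_v1 ?prednK // add0n prednK.
- have [hE hT hS] := IH (ltnW hi); set k := kf i in hE hT hS *.
  have hT' s : s \in words B i.+1 -> word_weight s = 0 \/ tableau_word k.+1 s.
    case: s => [|g s]; first by rewrite mem_words.
    rewrite mem_words /= eqSS => /and3P[hs _ hall].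
    have hs' : s \in words B i by rewrite mem_words hs.
    have [h0|ht] := hT s hs'; first by left; rewrite h0 mul0r.
    rewrite (eqP hs) -/k; case hm : (nfree_heights k s g) => [|m].
      by left; rewrite /qVint big_ord0 !mulr0.
    by right; apply: (tableau_word_add ht _).2; rewrite hm.
  split=> //.
    by apply: exchange_add hE _ => c0 c; exact: color_gf_add.
  move=> hk; rewrite [iota 0 k.+1]/= color_gf_add ?size_iota //.
  rewrite ifF; last by rewrite mem_iota.
  have -> : count (fun b => b < 0)%N (iota 1 (kf i)) = 0%N by elim: (iota _ _).
  rewrite scale1r exchange_dn // -/k -!linearZ /= hS 1?ltnW // !linear_sum sum_words.
  apply: eq_big_seq => s hs; move: (hs); rewrite mem_words => /andP[/eqP hsz hall].
  pose v := Ehat k (map S (take k s) ++ free_heights k s).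
  have hv : Ehat k (map S (take k s) ++ free_heights k s) = v by [].
  clearbody v; rewrite hv !linearZ /= -hv hsz -/k.
  have [->|ht] := hT s hs.
    by rewrite scale0r big1 // => g _; rewrite mul0r scale0r.
  have hst : size (map S (take k s)) = k.
    by rewrite size_map size_takel // (tight_le ht).
  have := @Ehat_add B (map S (take k s)) (free_heights k s); rewrite hst => -> //; first last.
  + apply/allP => g /flatten_mapP[h]; rewrite mem_iota /= => hh /nseqP[-> _].
    by rewrite hsz in hh; lia.
  + by rewrite size_cat hst (tight_size ht).
  rewrite scaler_sumr; apply: eq_bigr => g _; rewrite scalerA -(count_free _ _ (tight_row ht)).
  have [hg|hg] := posnP (count_mem (g : nat) (free_heights k s)).
    by rewrite hg /qVint big_ord0 !mulr0 !scale0r.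
  congr (_ *: _).
  rewrite (count_free _ _ (tight_row ht)) in hg.
  have [hp ht'] := tableau_word_add ht hg.
  have := @Ehat_perm (g.+1 :: map S (take k s)) _ _ hp; rewrite /= hst => <- //.
  by rewrite size_cat hst -addSn (tight_size ht').
- have [hE hT hS] := IH hi.
  have hT' s : s \in words B i -> word_weight s = 0 \/ tableau_word k s.
    by move=> /hT [->|/tableau_word_forget [_ h]]; [left|right].
  split=> //.
    by apply: exchange_forget hE _ => c hc _; exact: color_gf_forget.
  (* From a window of size N+1 to size N the induction hypothesis gives no expansion, but both sides
     vanish: N+1 mutually adjacent vertices do not fit in N colors, and a tableau word has no window
     larger than N. *)
  rewrite leq_eqVlt => /orP[/eqP hkN|hkN].
    rewrite big_seq big1 => [|s hs]; last first.
      have [->|ht] := hT s hs; first by rewrite scale0r.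
      by have := tight_size ht; rewrite hkN; lia.
    rewrite color_gf_forget ?size_iota // big1 ?scaler0 // => c' _.
    apply: (hE _ _ _).1; first by rewrite size_rcons size_iota.
      by rewrite all_rcons ltn_ord; apply/allP => x; rewrite mem_iota hkN.
    by rewrite rcons_uniq mem_iota /= hkN add0n ltn_ord.
  have hio : rcons (iota 0 k) k = iota 0 k.+1 by rewrite -[k.+1]addn1 iotaD cats1.
  have -> : color_gf i k (iota 0 k) = symC k (N.-1 - k) (color_gf i k.+1 (rcons (iota 0 k) k)).
    rewrite color_gf_forget ?size_iota // /symC.
    have hN' : (N = k + (N.-1 - k).+1)%N by lia.
    (* The colors below k already occur in the window; the colors k + c' give the terms of
       [symC]. *)
    rewrite [in LHS]hN' big_split_ord /= big1 ?add0r => [|c' _]; last first.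
      apply: (hE _ _ _).1; first by rewrite size_rcons size_iota.
        rewrite all_rcons /=; apply/andP; split; first by have := ltn_ord c'; lia.
        by apply/allP => x; rewrite mem_iota; lia.
      by rewrite rcons_uniq mem_iota /= add0n ltn_ord.
    by apply: eq_bigr => c' _; rewrite exchange_up //; have := ltn_ord c'; lia.
  rewrite hio -linearZ hS // linear_sum; apply: eq_big_seq => s hs.
  have hZ a w : symC k (N.-1 - k) (a *: w) = a *: symC k (N.-1 - k) w by exact: linearZ.
  rewrite -[LHS]/(symC k (N.-1 - k) (word_weight s *: Ehat k.+1 _)) hZ Ehat_forget //.
  have [->|ht] := hT s hs; first by rewrite !scale0r.
  have [hp ht'] := tableau_word_forget ht.
  have hks := tight_le ht; congr (_ *: _).
  have hst : size (map S (take k s)) = k by rewrite size_map size_takel // ltnW.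
  rewrite (take_nth 0%N) // map_rcons cat_rcons.
  have := @Ehat_perm (map S (take k s)) _ _ hp; rewrite hst => -> //.
  by rewrite size_cat hst (tight_size ht').
Qed.

(** Such a form multiplies by [N]_q! under symmetrization, which cancels [qfact]. With an empty
    window all heights may be sorted, and E is then a monomial. *)
Lemma color_gf_expansion_form (f : {linear V -> L^o}) B i : (0 < N)%N -> (i <= B)%N ->
  kf i = 0%N -> qfact != 0 ->
  (forall j v, (j.+1 < N)%N -> f (T j v) = q * f v) ->
  f (color_gf i 0 [::]) =
  \sum_(s <- words B i) word_weight s * f (monom 0 (sort leq (free_heights 0 s))).
Proof.
move=> hN hi hk hq hf; have hkN : (kf i <= N)%N by rewrite hk.
have [hT hG] := color_gf_expansion hN hi hkN; rewrite hk in hT hG.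
have hZ a w : f (a *: w) = a * f w by exact: linearZ.
have := congr1 f hG; rewrite hZ => h.
apply: (mulfI hq); rewrite [LHS]h linear_sum mulr_sumr; apply: eq_big_seq => s hs.
rewrite -[LHS]/(f (word_weight s *: Ehat 0 _)) hZ take0 /=.
have [->|ht] := hT s hs; first by rewrite !mul0r mulr0.
have hsN : size ([::] ++ free_heights 0 s) = N by rewrite /= -(tight_size ht).
have hp : perm_eq (free_heights 0 s) (sort leq (free_heights 0 s)) by rewrite perm_sym perm_sort.
have := @Ehat_perm [::] _ _ hp hsN; rewrite /= => ->.
have hso : sorted leq (sort leq (free_heights 0 s)) by apply: sort_sorted; exact: leq_total.
rewrite /Ehat inv_sorted // scale1r subn0 heckeE_sorted //.
rewrite hecke_sym_eigen; [|lia|by move=> j w hj; apply: hf; lia].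
by rewrite prednK // mulrCA.
Qed.

End HeckeModule.

Lemma swap_succ_l i : swap_succ i i = i.+1.
Proof. by rewrite /swap_succ eqxx. Qed.

Lemma swap_succ_r i : swap_succ i i.+1 = i.
Proof. by rewrite /swap_succ gtn_eqF // eqxx. Qed.

Lemma swap_succ_out i j : j != i -> j != i.+1 -> swap_succ i j = j.
Proof. by rewrite /swap_succ => /negPf -> /negPf ->. Qed.

Lemma swap_succ_ltn i x y :
  (swap_succ i x < swap_succ i y)%N && ~~ ((swap_succ i x == i) && (swap_succ i y == i.+1)) =
  (x < y)%N && ~~ ((x == i) && (y == i.+1)).
Proof.
apply/idP/idP; rewrite /swap_succ.
  by have [->|/eqP n1] := @eqP _ x i; have [->|n2] := @eqP _ y i;
    have [?|n3] := @eqP _ x i.+1; have [?|n4] := @eqP _ y i.+1; lia.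
by have [->|n1] := @eqP _ x i; have [->|n2] := @eqP _ y i;
    have [?|n3] := @eqP _ x i.+1; have [?|n4] := @eqP _ y i.+1; lia.
Qed.

(** * Words as functions on ['I_n], and an interpolation identity *)

Fixpoint word (c : nat -> nat) (i : nat) : seq nat :=
  if i is i'.+1 then c i' :: word c i' else [::].

Lemma size_word c i : size (word c i) = i.
Proof. by elim: i => //= i ->. Qed.

Lemma eq_word c c' i : (forall j, (j < i)%N -> c j = c' j) -> word c i = word c' i.
Proof.
elim: i => //= i IH h; rewrite h // IH // => j hj.
by apply: h; exact: ltnW.
Qed.

Lemma nth_word c i j : (j < i)%N -> nth 0%N (word c i) (i - j.+1) = c j.
Proof.
elim: i => // i IH; rewrite ltnS leq_eqVlt => /orP[/eqP ->|hj].
  by rewrite subnn.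
by have -> : (i.+1 - j.+1 = (i - j.+1).+1)%N by [lia]; rewrite /= IH.
Qed.

Lemma word_nth s : word (fun j => nth 0%N s (size s - j.+1)) (size s) = s.
Proof.
elim: s => //= x s IH; rewrite subnn /=; congr (_ :: _).
rewrite -[RHS]IH; apply: eq_word => j hj.
by have -> : ((size s).+1 - j.+1 = (size s - j.+1).+1)%N by lia.
Qed.

Lemma words_uniq B i : uniq (words B i).
Proof.
elim: i => //= i IH; apply: allpairs_uniq; rewrite ?iota_uniq //.
by move=> [s g] [s' g'] _ _ [-> ->].
Qed.

Definition extend (n B : nat) (k : {ffun 'I_n -> 'I_B}) (j : nat) : nat :=
  if insub j is Some o then nat_of_ord (k o) else 0%N.

Lemma extendE n B (k : {ffun 'I_n -> 'I_B}) (j : 'I_n) : extend k j = k j.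
Proof. by rewrite /extend valK. Qed.

Lemma sum_words_ffun (R : nmodType) B n (F : seq nat -> R) :
  \sum_(s <- words B n) F s = \sum_(k : {ffun 'I_n -> 'I_B}) F (word (extend k) n).
Proof.
pose wd (k : {ffun 'I_n -> 'I_B}) := word (extend k) n.
rewrite -(big_map wd xpredT); apply: perm_big; apply: uniq_perm.
- exact: words_uniq.
- rewrite map_inj_uniq ?index_enum_uniq // => k k' h; apply/ffunP => j.
  apply: val_inj; rewrite /= -!extendE -(nth_word (extend k) (ltn_ord j)).
  by rewrite -/(wd k) h nth_word.
move=> s; apply/idP/mapP => [|[k _ ->]].
  rewrite mem_words => /andP[/eqP hs hall].
  have hn (j : 'I_n) : (nth 0 s (n - j.+1) < B)%N.
    by apply: (allP hall); rewrite mem_nth // hs; have := ltn_ord j; lia.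
  exists [ffun j => Ordinal (hn j)]; first by rewrite mem_index_enum.
  rewrite -{1}(word_nth s) hs; apply: eq_word => j hj.
  by rewrite -[j]/(val (Ordinal hj)) extendE ffunE.
rewrite mem_words size_word eqxx /=.
suff h i : (i <= n)%N -> all (fun g => g < B)%N (word (extend k) i) by apply: h.
elim: i => //= i IH hi; rewrite IH ?(ltnW hi) // andbT.
by rewrite -[i]/(val (Ordinal hi)) extendE.
Qed.

Lemma word_weight_word (L : fieldType) (q : L) N kf r i : word_weight q N kf (word r i) =
  \prod_(j < i) (q ^+ count (fun b => r j < b)%N (map S (take (kf j) (word r j))) *
                 qVint q (nfree_heights N (kf j) (word r j) (r j))).
Proof.
elim: i => [|i IH] /=; first by rewrite big_ord0.
by rewrite big_ord_recr /= IH size_word.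
Qed.

(** Lagrange interpolation, read off in degree m. *)
Lemma lead_coef_interpolation (F : fieldType) m (a : 'I_m.+1 -> F) (r : {poly F}) :
  injective a -> (size r <= m.+1)%N ->
  \sum_k r.[a k] / \prod_(j | j != k) (a k - a j) = r`_m.
Proof.
move=> ha hr; pose w k := \prod_(j | j != k) ('X - (a j)%:P).
have hw k : w k \is monic by apply: monic_prod => j _; exact: monicXsubC.
have hsw k : size (w k) = m.+1.
  rewrite /w -big_filter size_prod_XsubC; congr S.
  apply/eqP; rewrite -[X in _ == X]/(m.+1.-1) -[X in _ == X.-1]card_ord -(cardC1 k).
  by rewrite cardE /enum_mem /index_enum.
have hwk k : (w k).[a k] = \prod_(j | j != k) (a k - a j).
  by rewrite horner_prod; apply: eq_bigr => j _; rewrite !hornerE.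
have hwj k j : j != k -> (w k).[a j] = 0.
  by move=> hjk; rewrite horner_prod (bigD1 j) //= !hornerE subrr mul0r.
have hnz k : \prod_(j | j != k) (a k - a j) != 0.
  apply/prodf_neq0 => j hj; rewrite subr_eq0; apply: contraNneq hj => /ha ->.
  by [].
pose l := \sum_k (r.[a k] / \prod_(j | j != k) (a k - a j)) *: w k.
have hrl : r = l.
  apply/eqP; rewrite -subr_eq0; apply: contraT => hne.
  have := max_poly_roots hne (rs := [seq a k | k <- enum 'I_m.+1]).
  rewrite map_inj_uniq ?enum_uniq // size_map size_enum_ord => /(_ _ isT) h.
  have: (m.+1 < size (r - l)%R)%N.
    apply: h; apply/allP => x /mapP[k _ ->].
    rewrite rootE hornerD hornerN /l horner_sum (bigD1 k) //= [X in _ - (_ + X)]big1 ?addr0.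
      by rewrite hornerZ hwk divfK // subrr.
    by move=> j hj; rewrite hornerZ hwj ?mulr0 // eq_sym.
  rewrite ltnNge (leq_trans (size_polyD _ _)) // size_polyN geq_max hr /=.
  apply: (leq_trans (size_sum _ _ _)); apply/bigmax_leqP => k _.
  by rewrite (leq_trans (size_scale_leq _ _)) // hsw.
rewrite [in RHS]hrl coef_sum; apply: eq_bigr => k _.
rewrite coefZ; have := hw k; rewrite monicE lead_coefE hsw => /eqP ->.
by rewrite mulr1.
Qed.

(** Interpolation of r = (prod_j (X - q a_j) - q^m prod_j (X - a_j)) / X: the constant terms cancel,
    the second product vanishes at each a_k, and the coefficient of degree m-1 of r is 1 - q^m. *)
Lemma sum_ratio (F : fieldType) m (a : 'I_m -> F) (q : F) :
  injective a -> (forall k, a k != 0) -> q != 1 ->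
  \sum_k \prod_(j | j != k) ((a k - q * a j) / (a k - a j)) = \sum_(r < m) q ^+ r.
Proof.
case: m a => [|m] a ha ha0 hq; first by rewrite !big_ord0.
pose p : {poly F} := \prod_j ('X - (q * a j)%:P) - q ^+ m.+1 *: \prod_j ('X - (a j)%:P).
have hp0 : p.[0] = 0.
  rewrite /p hornerD hornerN hornerZ !horner_prod.
  rewrite (eq_bigr (fun j => q * - a j)); last by move=> j _; rewrite !hornerE mulrN.
  rewrite [X in _ - _ * X](eq_bigr (fun j => - a j)); last by move=> j _; rewrite !hornerE.
  by rewrite big_split /= prodr_const card_ord subrr.
have /factor_theorem[r hr] : root p 0 by rewrite rootE hp0.
rewrite subr0 in hr.
have hsp (b : 'I_m.+1 -> F) : size (\prod_j ('X - (b j)%:P)) = m.+2.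
  by rewrite size_prod_XsubC /index_enum -enumT size_enum_ord.
have hspn (b : 'I_m.+1 -> F) : (\prod_j ('X - (b j)%:P))`_m.+1 = 1.
  have := monic_prod_XsubC (index_enum 'I_m.+1) xpredT b.
  by rewrite monicE lead_coefE hsp => /eqP.
have hpm : p`_m.+1 = 1 - q ^+ m.+1 by rewrite coefB coefZ !hspn mulr1.
have hsize : (size r <= m.+1)%N.
  have [->|hr0] := eqVneq r 0; first by rewrite size_poly0.
  have : (size p <= m.+2)%N.
    rewrite (leq_trans (size_polyD _ _)) // size_polyN geq_max hsp leqnn /=.
    by rewrite (leq_trans (size_scale_leq _ _)) // hsp.
  by rewrite hr size_mulX.
have := lead_coef_interpolation ha hsize.
have -> : r`_m = 1 - q ^+ m.+1 by rewrite -hpm hr coefMX.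
have hra k : r.[a k] = (1 - q) * \prod_(j | j != k) (a k - q * a j).
  apply: (mulIf (ha0 k)).
  have -> : r.[a k] * a k = p.[a k] by rewrite hr hornerMX.
  rewrite /p hornerD hornerN hornerZ !horner_prod (bigD1 k) //=.
  rewrite [X in _ - _ * X](bigD1 k) //= [X in _ - _ * (X * _)](_ : _ = 0); last by rewrite !hornerE subrr.
  rewrite mul0r mulr0 subr0 hornerXsubC.
  rewrite [RHS]mulrAC [(1 - q) * _]mulrBl mul1r; congr (_ * _).
  by apply: eq_bigr => j _; rewrite !hornerE.
move=> h; apply: (mulfI (x := 1 - q)); first by rewrite subr_eq0 eq_sym.
have -> : (1 - q) * \sum_(r < m.+1) q ^+ r = 1 - q ^+ m.+1.
  by rewrite -[RHS]opprB subrX1 -mulNr opprB.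
rewrite -h mulr_sumr.
apply: eq_bigr => k _; rewrite hra -mulrA; congr (_ * _).
by rewrite prodf_div.
Qed.

(** * The Demazure-Lusztig representation and the Hall-Littlewood kernel *)

Section HallLittlewoodKernel.
Variables (L : fieldType) (q : L).

(* The kernel of the Hall-Littlewood symmetrization, at the point a \o w. *)
Definition kernel (N : nat) (a : 'I_N -> L) (w : 'S_N) : L :=
  \prod_(i < N) \prod_(j < N | (i < j)%N)
    ((a (w i) - q * a (w j)) / (a (w i) - a (w j))).

(** The permutations with w(0) = k contribute the factors of a_k times the kernel sum of the other
    points; the sum over k is [sum_ratio]. *)
Lemma sum_kernel N (a : 'I_N -> L) :
  injective a -> (forall k, a k != 0) -> q != 1 ->
  \sum_w kernel a w = \prod_(d < N) \sum_(r < d.+1) q ^+ r.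
Proof.
move=> ha ha0 hq; elim: N a ha ha0 => [|N IH] a ha ha0.
  rewrite big_ord0 (big_pred1 (1%g : 'S_0)) => [|w]; first by rewrite /kernel big_ord0.
  by apply/esym/eqP/permP => -[].
pose lp (p : 'I_N.+1 * 'S_N) : 'S_N.+1 := lift_perm ord0 p.1 p.2.
have hlp : bijective lp.
  have hinj : injective lp.
    move=> [k s] [k' s'] /permP h.
    have e : k = k' by have := h ord0; rewrite /lp /= !lift_perm_id.
    rewrite -{}e in h *; congr (_, _); apply/permP => i.
    by have := h (lift ord0 i); rewrite /lp /= !lift_perm_lift => /lift_inj.
  by apply: inj_card_bij => //; rewrite card_prod card_ord !card_Sn factS.
rewrite (reindex lp) /=; last exact: onW_bij.
transitivity (\sum_(k < N.+1) \sum_(s : 'S_N)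
   (\prod_(j | j != k) ((a k - q * a j) / (a k - a j))) * kernel (a \o lift k) s).
  rewrite pair_big /=; apply: eq_bigr => -[k s] _; rewrite /lp /kernel /= big_ord_recl.
  congr (_ * _).
    rewrite lift_perm_id big_mkcond big_ord_recl /= mul1r.
    under eq_bigr => i _ do rewrite lift_perm_lift.
    rewrite -(reindex_inj (h := s) (P := xpredT)
      (F := fun j => (a k - q * a (lift k j)) / (a k - a (lift k j)))); last exact: perm_inj.
    rewrite [RHS]big_mkcond (bigD1_ord k) //= eqxx mul1r.
    by apply: eq_bigr => j _; rewrite eq_sym neq_lift.
  apply: eq_bigr => i _; rewrite big_mkcond big_ord_recl /= mul1r [RHS]big_mkcond.
  by apply: eq_bigr => j _; rewrite !lift_perm_lift.
rewrite [RHS]big_ord_recr /= mulrC -(sum_ratio ha) // mulr_suml.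
apply: eq_bigr => k _; rewrite -big_distrr IH // => [x y /ha /lift_inj //|j]; exact: ha0.
Qed.

Variables (N' : nat) (a : 'I_N'.+1 -> L).
Let N := N'.+1.
Hypothesis a_inj : injective a.
Hypothesis q_neq0 : q != 0.

Definition point (w : 'S_N) (j : nat) : L := if (j < N)%N then a (w (inord j)) else 1.

(** A product in ['S_N] applies its left factor first, so left multiplication by [sadj i] exchanges
    the coordinates i and i+1 of the point. *)
Definition sadj (i : nat) : 'S_N := tperm (inord i) (inord i.+1).

Lemma point_sadj i w j : (i.+1 < N)%N -> point (sadj i * w)%g j = point w (swap_succ i j).
Proof.
move=> hi; have hswN : (swap_succ i j < N)%N = (j < N)%N.
  apply/idP/idP; last exact: swap_succ_lt.
  by rewrite -{2}(swap_succK i j); exact: swap_succ_lt.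
rewrite /point hswN; case: ifP => // hj; rewrite permM; congr (a (w _)).
have hv x : (x < N)%N -> (inord x : 'I_N) = x :> nat by move=> hx; rewrite inordK.
have heq x y : (x < N)%N -> (y < N)%N -> ((inord x : 'I_N) == inord y) = (x == y).
  by move=> hx hy; rewrite -val_eqE /= !hv.
rewrite /sadj /swap_succ permE /= !heq //; last exact: ltnW.
by case: eqP => // _; case: eqP.
Qed.

Lemma point_neq w i j : (i < N)%N -> (j < N)%N -> i != j -> point w i != point w j.
Proof.
move=> hi hj; apply: contraNneq; rewrite /point hi hj => /a_inj /perm_inj /(congr1 val) /=.
by rewrite !inordK // => ->.
Qed.

Lemma sadjK i : (sadj i * sadj i = 1)%g.
Proof. by rewrite /sadj tperm2. Qed.

Lemma sadj_mulK i w : (sadj i * (sadj i * w) = w)%g.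
Proof. by rewrite mulgA sadjK mul1g. Qed.

Lemma sadj_far i j : (i.+1 < j)%N -> (j.+1 < N)%N ->
  (sadj i * sadj j = sadj j * sadj i)%g.
Proof.
move=> hij hj; rewrite conjgC tpermJ.
have h x y : (x < N)%N -> (y < N)%N -> x != y -> (inord x : 'I_N) != inord y.
  by move=> hx hy; rewrite -val_eqE /= !inordK.
by rewrite !tpermD //; apply: h; lia.
Qed.

Lemma sadj_braid i : (i.+2 < N)%N ->
  (sadj i * sadj i.+1 * sadj i = sadj i.+1 * sadj i * sadj i.+1)%g.
Proof.
move=> hi.
have h x y : (x < N)%N -> (y < N)%N -> x != y -> (inord x : 'I_N) != inord y.
  by move=> hx hy; rewrite -val_eqE /= !inordK.
have conj (x y : 'S_N) : (y * y = 1)%g -> (y * x * y = x ^ y)%g.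
  by move=> hy; rewrite conjgE -mulgA; congr (_ * _)%g; rewrite -[y^-1%g]mulg1 -hy mulKg.
rewrite !conj ?sadjK // !tpermJ /sadj tpermR tpermL.
by rewrite !tpermD //; apply: h; lia.
Qed.

Definition permfun := {ffun 'S_N -> L^o}.

Definition demazure (i : nat) (f : permfun) : permfun :=
  [ffun w => ((q * point w i - point w i.+1) * f (sadj i * w)%g
              + (1 - q) * point w i.+1 * f w) / (point w i - point w i.+1)].

Lemma demazure_is_linear i : linear (demazure i).
Proof.
move=> c f g; apply/ffunP => w; rewrite !ffunE /GRing.scale /=; ring.
Qed.
HB.instance Definition _ i :=
  GRing.isLinear.Build L permfun permfun *:%R (demazure i) (demazure_is_linear i).

Definition mulpt (i : nat) (f : permfun) : permfun := [ffun w => point w i * f w].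

Lemma mulpt_is_linear i : linear (mulpt i).
Proof.
move=> c f g; apply/ffunP => w; rewrite !ffunE /GRing.scale /=; ring.
Qed.
HB.instance Definition _ i :=
  GRing.isLinear.Build L permfun permfun *:%R (mulpt i) (mulpt_is_linear i).

Definition fone : permfun := [ffun => 1].

Lemma sub_neq0 w i j : (i < N)%N -> (j < N)%N -> i != j -> point w i - point w j != 0.
Proof. by move=> *; rewrite subr_eq0 point_neq. Qed.

Lemma demazure_quad i f : (i.+1 < N)%N ->
  demazure i (demazure i f) = (q - 1) *: demazure i f + q *: f.
Proof.
move=> hi; apply/ffunP => w; rewrite !ffunE /GRing.scale /= sadj_mulK !point_sadj //.
rewrite swap_succ_l swap_succ_r.
have h1 : point w i - point w i.+1 != 0 by apply: sub_neq0; lia.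
have h2 : point w i.+1 - point w i != 0 by apply: sub_neq0; lia.
by field; rewrite h1 h2.
Qed.

Lemma demazure_braid i f : (i.+2 < N)%N ->
  demazure i (demazure i.+1 (demazure i f)) =
  demazure i.+1 (demazure i (demazure i.+1 f)).
Proof.
move=> hi; have hi1 : (i.+1 < N)%N by lia.
have e1 : swap_succ i i.+2 = i.+2 by rewrite swap_succ_out // gtn_eqF.
have e2 : swap_succ i.+1 i = i by rewrite swap_succ_out // ltn_eqF.
apply/ffunP => w; rewrite !ffunE !sadj_mulK !point_sadj //.
rewrite !(swap_succ_l, swap_succ_r, e1, e2).
have := sadj_braid hi; move=> hb.
have hbw : (sadj i.+1 * (sadj i * (sadj i.+1 * w)) = sadj i * (sadj i.+1 * (sadj i * w)))%g.
  by rewrite !mulgA hb.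
rewrite hbw.
have h1 : point w i - point w i.+1 != 0 by apply: sub_neq0; lia.
have h2 : point w i.+1 - point w i != 0 by apply: sub_neq0; lia.
have h3 : point w i - point w i.+2 != 0 by apply: sub_neq0; lia.
have h4 : point w i.+2 - point w i != 0 by apply: sub_neq0; lia.
have h5 : point w i.+1 - point w i.+2 != 0 by apply: sub_neq0; lia.
have h6 : point w i.+2 - point w i.+1 != 0 by apply: sub_neq0; lia.
set x := point w i in h1 h2 h3 h4 *; set y := point w i.+1 in h1 h2 h5 h6 *.
set z := point w i.+2 in h3 h4 h5 h6 *.
by field; rewrite ?h1 ?h2 ?h3 ?h4 ?h5 ?h6.
Qed.

Lemma demazure_far i j f : (i.+1 < j)%N -> (j.+1 < N)%N ->
  demazure i (demazure j f) = demazure j (demazure i f).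
Proof.
move=> hij hj; have hi : (i.+1 < N)%N by lia.
have e1 : swap_succ i j = j by rewrite swap_succ_out //; lia.
have e2 : swap_succ i j.+1 = j.+1 by rewrite swap_succ_out //; lia.
have e3 : swap_succ j i = i by rewrite swap_succ_out //; lia.
have e4 : swap_succ j i.+1 = i.+1 by rewrite swap_succ_out //; lia.
apply/ffunP => w; rewrite !ffunE !point_sadj // e1 e2 e3 e4.
have -> : (sadj j * (sadj i * w) = sadj i * (sadj j * w))%g by rewrite !mulgA (sadj_far hij hj).
have h1 : point w i - point w i.+1 != 0 by apply: sub_neq0; lia.
have h2 : point w j - point w j.+1 != 0 by apply: sub_neq0; lia.
by field; rewrite ?h1 ?h2.
Qed.

Lemma demazure_mulpt i f : (i.+1 < N)%N ->
  demazure i (mulpt i (demazure i f)) = q *: mulpt i.+1 f.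
Proof.
move=> hi; apply/ffunP => w; rewrite !ffunE /GRing.scale /= sadj_mulK !point_sadj //.
rewrite swap_succ_l swap_succ_r.
have h1 : point w i - point w i.+1 != 0 by apply: sub_neq0; lia.
have h2 : point w i.+1 - point w i != 0 by apply: sub_neq0; lia.
by field; rewrite ?h1 ?h2.
Qed.

Lemma demazure_mulpt_far i j f : (i.+1 < N)%N -> j != i -> j != i.+1 ->
  demazure i (mulpt j f) = mulpt j (demazure i f).
Proof.
move=> hi h h'; apply/ffunP => w; rewrite !ffunE point_sadj // swap_succ_out //.
have h1 : point w i - point w i.+1 != 0 by apply: sub_neq0; lia.
by field.
Qed.

Lemma mulpt_comm i j f : mulpt i (mulpt j f) = mulpt j (mulpt i f).
Proof. by apply/ffunP => w; rewrite !ffunE mulrCA. Qed.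

Lemma demazure_one i : (i.+1 < N)%N -> demazure i fone = q *: fone.
Proof.
move=> hi; apply/ffunP => w; rewrite !ffunE /GRing.scale /=.
have h1 : point w i - point w i.+1 != 0 by apply: sub_neq0; lia.
by field.
Qed.

Definition angle (f : permfun) : L^o := \sum_w f w * kernel a w.

Lemma angle_is_linear : linear angle.
Proof.
move=> c f g; rewrite /angle scaler_sumr -big_split; apply: eq_bigr => w _.
by rewrite !ffunE /GRing.scale /= mulrDl mulrA.
Qed.
HB.instance Definition _ :=
  GRing.isLinear.Build L permfun L^o *:%R angle angle_is_linear.

(** The exchange permutes the factors of all pairs other than (i, i+1); the identity compares the
    two values of the remaining factor, with denominators cleared. *)
Lemma kernel_sadj i w : (i.+1 < N)%N ->
  kernel a (sadj i * w)%g * (point w i - q * point w i.+1) * (point w i.+1 - point w i) =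
  kernel a w * (point w i.+1 - q * point w i) * (point w i - point w i.+1).
Proof.
move=> hi; have hi' : (i < N)%N by lia.
pose F (w : 'S_N) (p : 'I_N * 'I_N) :=
  (a (w p.1) - q * a (w p.2)) / (a (w p.1) - a (w p.2)).
have hk u : kernel a u = \prod_(p : 'I_N * 'I_N | (p.1 < p.2)%N) F u p.
  by rewrite /kernel pair_big_dep.
pose p0 : 'I_N * 'I_N := (inord i, inord i.+1).
have v0 : (inord i : 'I_N) = i :> nat by rewrite inordK.
have v1 : (inord i.+1 : 'I_N) = i.+1 :> nat by rewrite inordK.
have hp0 : (p0.1 < p0.2)%N by rewrite /p0 /= v0 v1.
have hF u : F u p0 = (point u i - q * point u i.+1) / (point u i - point u i.+1).
  by rewrite /F /point hi hi'.
have hrest : \prod_(p : 'I_N * 'I_N | (p.1 < p.2)%N && (p != p0)) F (sadj i * w)%g p =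
             \prod_(p : 'I_N * 'I_N | (p.1 < p.2)%N && (p != p0)) F w p.
  pose h (p : 'I_N * 'I_N) := (sadj i p.1, sadj i p.2).
  have hh : injective h.
    by move=> [x y] [x' y'] [] /perm_inj -> /perm_inj ->.
  have hv x : sadj i x = swap_succ i x :> nat.
    have e (y : nat) : (y < N)%N -> (x == inord y) = (x == y :> nat).
      by move=> hy; rewrite -val_eqE /= inordK.
    rewrite /sadj permE /= /swap_succ !e //.
    by case: eqP => _; rewrite ?inordK //; case: eqP => _; rewrite ?inordK.
  rewrite [RHS](reindex_inj hh) /=; apply: eq_big => [[x y]|p _] /=; last first.
    by rewrite /F !permM.
  rewrite /p0 /h /= !xpair_eqE -!val_eqE /= !hv v0 v1.
  exact/esym/swap_succ_ltn.
rewrite !hk (bigD1 p0) //= [in RHS](bigD1 p0) //= hrest !hF !point_sadj // swap_succ_l swap_succ_r.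
have h1 : point w i - point w i.+1 != 0 by apply: sub_neq0; lia.
have h2 : point w i.+1 - point w i != 0 by apply: sub_neq0; lia.
by field; rewrite ?h1 ?h2.
Qed.

(** Let g be the coefficient of s_i f in T_i f; that of f is q - g. Since g times the kernel is
    invariant under s_i, the terms in g cancel after reindexing. *)
Lemma angle_demazure i f : (i.+1 < N)%N -> angle (demazure i f) = q * angle f.
Proof.
move=> hi; rewrite /angle mulr_sumr.
pose g w := (q * point w i - point w i.+1) / (point w i - point w i.+1).
transitivity (\sum_w (g w * f (sadj i * w)%g * kernel a w + (q - g w) * f w * kernel a w)).
  apply: eq_bigr => w _; rewrite ffunE /g.
  have h1 : point w i - point w i.+1 != 0 by apply: sub_neq0; lia.
  by field.
rewrite big_split /= (reindex_inj (mulgI (sadj i))) /= -big_split /=.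
apply: eq_bigr => w _; rewrite sadj_mulK /g !point_sadj // swap_succ_l swap_succ_r.
have h1 : point w i - point w i.+1 != 0 by apply: sub_neq0; lia.
have h2 : point w i.+1 - point w i != 0 by apply: sub_neq0; lia.
have := kernel_sadj w hi; set k1 := kernel _ _; set k2 := kernel _ _ => hk.
apply/eqP; rewrite -subr_eq0; apply/eqP.
set x := point w i in h1 h2 hk *; set y := point w i.+1 in h1 h2 hk *.
have hk1 : k1 * (q * y - x) / (y - x) = k2 * (q * x - y) / (x - y).
  apply: (mulIf h1); apply: (mulIf h2).
  have -> : k1 * (q * y - x) / (y - x) * (x - y) * (y - x) = - (k1 * (x - q * y) * (x - y)).
    by field; rewrite ?h1 ?h2.
  have -> : k2 * (q * x - y) / (x - y) * (x - y) * (y - x) = k2 * (y - q * x) * (x - y).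
    by field; rewrite ?h1 ?h2.
  by rewrite -hk; ring.
have -> : (q * y - x) / (y - x) * f w * k1 = f w * (k1 * (q * y - x) / (y - x)).
  by ring.
by rewrite hk1; field; rewrite ?h1 ?h2.
Qed.

Lemma invariant_const (f : permfun) :
  (forall i w, (i.+1 < N)%N -> f (sadj i * w)%g = f w) -> forall w, f w = f 1%g.
Proof.
move=> hf; pose H (u : 'S_N) := forall w, f (u * w)%g = f w.
have hM u v : H u -> H v -> H (u * v)%g by move=> hu hv w; rewrite -mulgA hu hv.
have ht i d : (i + d < N)%N -> H (tperm (inord i) (inord (i + d))).
  elim: d => [|[|d] IH] hd w; first by rewrite addn0 tperm1 mul1g.
    by rewrite addn1 hf // -addn1.
  have h x y : (x < N)%N -> (y < N)%N -> x != y -> (inord x : 'I_N) != inord y.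
    by move=> hx hy; rewrite -val_eqE /= !inordK.
  have -> : tperm (inord i) (inord (i + d.+2)) =
    (sadj (i + d.+1) * tperm (inord i) (inord (i + d.+1)) * sadj (i + d.+1))%g :> 'S_N.
    have -> : (sadj (i + d.+1) * tperm (inord i) (inord (i + d.+1)) * sadj (i + d.+1) =
       (tperm (inord i) (inord (i + d.+1))) ^ (sadj (i + d.+1)) :> 'S_N)%g.
      by rewrite conjgE /sadj tpermV mulgA.
    rewrite tpermJ /sadj tpermL tpermD ?addnS //; apply: h; lia.
  have hs : H (sadj (i + d.+1)) by move=> w'; apply: hf; lia.
  by apply: (hM _ _ (hM _ _ hs _) hs); apply: IH; lia.
have ht' x y : H (tperm x y).
  wlog hxy : x y / (x <= y)%N => [hw|].
    by have [/hw//|/ltnW/hw] := leqP x y; rewrite tpermC.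
  have := ht x (y - x)%N; rewrite subnKC // !inord_val; apply; exact: ltn_ord.
move=> w; have [ts -> _] := prod_tpermP w.
rewrite -[(\prod_(t <- ts) _)%g]mulg1; elim: ts => [|t ts IH]; first by rewrite big_nil mulg1.
by rewrite big_cons -mulgA ht' IH.
Qed.

Hypothesis a_generic : forall i j, i != j -> q * a i != a j.

(** The equation amounts to (q x_i - x_(i+1)) (s_i f - f) = 0, and genericity makes the first factor
    invertible. *)
Lemma demazure_invariant i (f : permfun) : (i.+1 < N)%N -> demazure i f = q *: f ->
  forall w, f (sadj i * w)%g = f w.
Proof.
move=> hi /ffunP h w; have := h w; rewrite !ffunE /GRing.scale /= => e.
have h1 : point w i - point w i.+1 != 0 by apply: sub_neq0; lia.
have h2 : q * point w i - point w i.+1 != 0.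
  rewrite subr_eq0 /point hi (ltnW hi); apply: a_generic; apply/eqP => /perm_inj /(congr1 val) /=.
  by rewrite !inordK //; lia.
apply: (mulfI h2); apply: (mulIf (invr_neq0 h1)).
apply/eqP; rewrite -subr_eq0; apply/eqP.
have -> : (q * point w i - point w i.+1) * f (sadj i * w)%g / (point w i - point w i.+1) =
  ((q * point w i - point w i.+1) * f (sadj i * w)%g + (1 - q) * point w i.+1 * f w) /
      (point w i - point w i.+1) - (1 - q) * point w i.+1 * f w / (point w i - point w i.+1).
  by field.
by rewrite e; field.
Qed.

Definition demazureL (i : nat) : {linear permfun -> permfun} := demazure i.
Definition mulptL (i : nat) : {linear permfun -> permfun} := mulpt i.
Definition angleL : {linear permfun -> L^o} := angle.

Lemma monomE w i s : (monom mulptL fone i s : permfun) w =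
  \prod_(j < size s) point w (i + j) ^+ nth 0%N s j.
Proof.
elim: s i => [|b s IH] i /=; first by rewrite big_ord0 ffunE.
rewrite big_ord_recl addn0 /=; under eq_bigr => j _ do rewrite /= -addSnnS.
rewrite -IH; elim: b => [|b IHb] /=; first by rewrite mul1r.
by rewrite ffunE IHb exprS mulrA.
Qed.

Lemma color_weight_word kf c i w : (color_weight q mulptL fone kf (word c i) : permfun) w =
  \prod_(j < i) (if c j \in take (kf j) (word c j) then 0 else
    q ^+ count (fun b => b < c j)%N (take (kf j) (word c j)) * point w (c j)).
Proof.
elim: i => [|i IH] /=; first by rewrite big_ord0 ffunE.
rewrite big_ord_recr /= size_word; case: ifP => _; first by rewrite ffunE mulr0.
by rewrite !ffunE IH /GRing.scale /=; ring.
Qed.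

(** With an empty window, the exchange property makes the generating function a q-eigenvector of
    every T_i, hence constant. Its value is recovered from [angle], up to the total mass [N]_q! of
    the kernel. *)
Lemma coloring_expansion (kf : nat -> nat) n :
  kf 0%N = 0%N -> (forall i, kf i.+1 <= (kf i).+1)%N -> kf n = 0%N ->
  (forall k, a k != 0) -> q != 1 -> qfact q N != 0 ->
  qfact q N * (\sum_(s <- words N n) color_weight q mulptL fone kf s : permfun) 1%g =
  \sum_(s <- words n n) word_weight q N kf s *
    (\sum_(w : 'S_N) (\prod_(j < N) a (w j) ^+ nth 0%N (sort leq (free_heights N 0 s)) j) * kernel a w).
Proof.
move=> kf0 kfS hkn ha0 hq1 hqf.
have hX i j f : (i.+1 < N)%N -> j != i -> j != i.+1 ->
  demazureL i (mulptL j f) = mulptL j (demazureL i f) by exact: demazure_mulpt_far.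
have hexch := color_gf_exchange (T := demazureL) q_neq0 demazure_quad
   (X := mulptL) (v1 := fone) demazure_mulpt hX demazure_one kf0 kfS (i := n).
have := @color_gf_expansion_form L permfun q N demazureL q_neq0 demazure_quad demazure_braid
  demazure_far mulptL fone demazure_mulpt hX mulpt_comm demazure_one kf kf0 kfS
  angleL n n isT (leqnn n) hkn hqf (fun i f => @angle_demazure i f).
rewrite hkn in hexch.
have hG : color_gf q N mulptL fone kf n 0 [::] = \sum_(s <- words N n) color_weight q mulptL fone kf s.
  by rewrite /color_gf; apply: eq_bigl => s; rewrite take0.
rewrite hG; set g := \sum_(s <- words N n) _ => he.
have hgc w : g w = g 1%g.
  apply: invariant_const => i u hi; apply: demazure_invariant => //.
  have [_ h] := hexch [::] erefl isT; have [h' _] := h i hi isT.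
  by move: (h' isT isT); rewrite hG.
have -> : qfact q N * g 1%g = angleL g.
  rewrite /qfact -(sum_kernel a_inj ha0 hq1) mulrC mulr_sumr.
  by apply: eq_bigr => w _; rewrite hgc.
have [hT _] : (forall s, s \in words n n -> word_weight q N kf s = 0 \/ tableau_word N 0 s) /\
    qfact q N *: color_gf q N mulptL fone kf n 0 [::] =
    \sum_(s <- words n n) word_weight q N kf s *:
      Ehat q N demazureL mulptL fone 0 (map S (take 0 s) ++ free_heights N 0 s).
  have h := @color_gf_expansion L permfun q N demazureL q_neq0 demazure_quad demazure_braid
    demazure_far mulptL fone demazure_mulpt hX mulpt_comm demazure_one kf kf0 kfS
    n n isT (leqnn n); rewrite hkn in h; exact: h.
rewrite he; apply: eq_big_seq => s hs.
have [->|ht] := hT s hs; first by rewrite !mul0r.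
congr (_ * _); apply: eq_bigr => w _; congr (_ * _).
rewrite monomE size_sort -[size _]/(0 + size _)%N (tight_size ht).
by apply: eq_bigr => j _; rewrite add0n /point ltn_ord inord_val.
Qed.
End HallLittlewoodKernel.

Lemma drop_word c i m : (m <= i)%N -> drop (i - m) (word c i) = word c m.
Proof.
move=> hm; rewrite -{2}(subnK hm) addnC; move: (i - m)%N => d.
by elim: d => [|d IH]; rewrite ?addn0 ?drop0 // addnS.
Qed.

Lemma count_word P c i : count P (word c i) = (\sum_(j < i) P (c j))%N.
Proof. by elim: i => [|i IH]; rewrite ?big_ord0 //= big_ord_recr /= IH addnC. Qed.

Lemma count_take_word P c i m : (m <= i)%N ->
  count P (take (i - m) (word c i)) = (\sum_(m <= j < i) P (c j))%N.
Proof.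
move=> hm; apply/eqP; rewrite -(eqn_add2r (count P (drop (i - m) (word c i)))).
rewrite -count_cat cat_take_drop drop_word // !count_word addnC.
by rewrite -!(big_mkord xpredT (fun j => nat_of_bool (P (c j)))) /= -big_cat_nat.
Qed.

(** * Windows of a reverse Hessenberg function *)

Section Window.
Variables (n : nat) (e : 'I_n -> 'I_n).
Hypothesis he : rev_hessenberg e.

(** The window of i is e i <= j < i. The default value 0, taken at i = n, empties the window once
    all vertices are read. *)
Definition kfun (i : nat) : nat := if insub i is Some o then (i - e o)%N else 0%N.

Lemma kfunE (i : 'I_n) : kfun i = (i - e i)%N.
Proof. by rewrite /kfun valK. Qed.

Lemma kfun0 : kfun 0%N = 0%N.
Proof. by rewrite /kfun; case: insubP. Qed.

Lemma kfunS i : (kfun i.+1 <= (kfun i).+1)%N.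
Proof.
rewrite /kfun; case: insubP => // o ho vo; have hi : (i < n)%N by exact: ltnW.
rewrite (insubT (fun x => x < n)%N hi).
have /he.1 : (Ordinal hi <= o)%N by rewrite vo /=.
by rewrite /= -[Sub i hi]/(Ordinal hi); lia.
Qed.

Lemma kfunn : kfun n = 0%N.
Proof. by rewrite /kfun insubF // ltnn. Qed.

Lemma e_le (i : 'I_n) : (e i <= i)%N.
Proof. exact: he.2. Qed.

Lemma count_window (P : pred nat) c (i : 'I_n) :
  count P (take (kfun i) (word c i)) = #|[set j : 'I_n | prec e j i & P (c j)]|.
Proof.
rewrite kfunE count_take_word ?e_le // cardsE -sum1_card.
rewrite (big_nat_widen _ _ n); last exact: ltnW.
rewrite big_geq_mkord.
rewrite big_mkcond [RHS]big_mkcond; apply: eq_bigr => j _.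
rewrite unfold_in /prec ltnS andbC /=.
by case: (_ && _) => //=; case: (P _).
Qed.

Lemma notin_window (c : nat -> nat) (i : 'I_n) :
  (c i \notin take (kfun i) (word c i)) = [forall j : 'I_n, prec e j i ==> (c j != c i)].
Proof.
rewrite -has_pred1 has_count count_window -eqn0Ngt cards_eq0.
apply/eqP/forallP => [h j|h].
  apply/implyP => hj; apply/eqP => hc.
  by have : j \in set0 by [rewrite -h inE hj /= hc eqxx]; rewrite inE.
by apply/setP => j; rewrite !inE; have := h j; case: (prec e j i) => //= /negPf.
Qed.

Lemma chromatic_words (L : comNzRingType) (N : nat) (q : L) (a : 'I_N -> L)
    (b : nat -> L) (hb : forall k : 'I_N, b k = a k) (kappa : {ffun 'I_n -> 'I_N}) :
  \prod_(j < n) (if extend kappa j \in take (kfun j) (word (extend kappa) j) then 0 else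
    q ^+ count (fun x => x < extend kappa j)%N (take (kfun j) (word (extend kappa) j)) *
    b (extend kappa j)) =
  if proper_coloring e kappa then q ^+ asc e kappa * \prod_(v < n) a (kappa v) else 0.
Proof.
have hp : proper_coloring e kappa = [forall j : 'I_n,
    extend kappa j \notin take (kfun j) (word (extend kappa) j)].
  apply/forallP/forallP => h j.
    rewrite notin_window; apply/forallP => i; apply/implyP => hij.
    by have /forallP/(_ j)/implyP/(_ hij) := h i; rewrite !extendE -val_eqE.
  apply/forallP => i; apply/implyP => hij.
  have := h i; rewrite notin_window => /forallP/(_ j)/implyP/(_ hij).
  by rewrite !extendE -val_eqE.
rewrite hp; case: ifP => [/forallP h|/negbT/forallPn[j]]; last first.
  by rewrite negbK => hj; rewrite (bigD1 j) //= hj mul0r.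
rewrite (eq_bigr (fun j : 'I_n => q ^+ #|[set i | prec e i j & (kappa i < kappa j)%N]| *
  a (kappa j))).
  rewrite big_split /= -expr_sum; congr (_ ^+ _ * _).
  rewrite /asc -sum1_card (eq_bigr (fun j => \sum_(i | prec e i j && (kappa i < kappa j)) 1)%N).
    rewrite (exchange_big_dep xpredT) //= pair_big_dep /=; apply: eq_bigl => -[i j].
    by rewrite inE.
  by move=> j _; rewrite -sum1_card; apply: eq_bigl => i; rewrite inE.
move=> j _; have /negPf -> := h j; rewrite count_window extendE hb; congr (_ ^+ _ * _).
by apply: eq_card => i; rewrite !inE extendE.
Qed.
End Window.

Lemma bigmin_leq (I : eqType) (s : seq I) (P : pred I) (F : I -> nat) m i :
  i \in s -> P i -> (\big[minn/m]_(j <- s | P j) F j <= F i)%N.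
Proof.
elim: s => // j s IH; rewrite inE big_cons => /predU1P[<- ->|hi hP].
  exact: geq_minl.
case: ifP => _; last exact: IH.
by apply: leq_trans (IH hi hP); exact: geq_minr.
Qed.

(** * Tableaux given by the rows of their entries *)

Section Tableau.
Variables (n' : nat).
Let n := n'.+1.
Variables (e : 'I_n -> 'I_n).
Hypothesis he : rev_hessenberg e.

Section Rows.
Variable rho : {ffun 'I_n -> 'I_n}.
Let r := extend rho.

Definition rowlen (g i : nat) : nat := count_mem g (word (extend rho) i).
Local Notation c := rowlen.

Definition tab : {ffun 'I_n -> 'I_n * 'I_n} :=
  [ffun i => (rho i, inord (c (rho i) i))].

Definition shape : n.-tuple 'I_n.+1 := [tuple inord (c g n) | g < n].

(* Entry i can be put on top of a column of height rho i that contains no entry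
   of its window. *)
Definition fits : Prop :=
  forall (i : 'I_n) g, rho i = g.+1 :> nat -> (c g.+1 i < c g (e i))%N.

Lemma rowlenS g i : c g i.+1 = ((r i == g) + c g i)%N.
Proof. by []. Qed.

Lemma rowlen_le g i : (c g i <= i)%N.
Proof. by rewrite /c -{2}(size_word (extend rho) i) count_size. Qed.

Lemma rowlen_mono g : {homo c g : i j / (i <= j)%N}.
Proof.
move=> i j; elim: j => [|j IH]; first by rewrite leqn0 => /eqP ->.
rewrite leq_eqVlt => /orP[/eqP-> //|/IH h].
by rewrite rowlenS (leq_trans h) ?leq_addl.
Qed.

Lemma rowlen_lt g i j : (i < j)%N -> r i = g -> (c g i < c g j)%N.
Proof.
move=> hij hi; apply: leq_trans (rowlen_mono g hij).
by rewrite rowlenS hi eqxx.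
Qed.

Lemma rowlen_inj i j : r i = r j -> c (r i) i = c (r j) j -> i = j.
Proof.
move=> h1 h2; have [h|h|//] := ltngtP i j.
  by have := rowlen_lt h erefl; rewrite h2 h1 ltnn.
by have := rowlen_lt h erefl; rewrite -h2 h1 ltnn.
Qed.

Lemma rowlen_onto g x m : (x < c g m)%N -> exists2 i, (i < m)%N & r i = g /\ c g i = x.
Proof.
elim: m => // m IH; rewrite rowlenS; have [hx|hx] := ltnP x (c g m).
  by move=> _; have [i hi h] := IH hx; exists i => //; exact: ltnW.
have [hr|_] := eqVneq (r m) g; last by rewrite ltnNge hx.
rewrite add1n ltnS => hx'; exists m => //; split=> //.
by apply/eqP; rewrite eqn_leq hx.
Qed.

Lemma r_lt i : (r i < n)%N.
Proof. by rewrite /r /extend; case: insubP => // o. Qed.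

Lemma rE (i : 'I_n) : r i = rho i.
Proof. exact: extendE. Qed.

Lemma rowlen_card g i : (i <= n)%N ->
  c g i = #|[set j : 'I_n | (j < i)%N & rho j == g :> nat]|.
Proof.
move=> hi; rewrite /c count_word -(big_mkord xpredT (fun j => nat_of_bool (r j == g))).
rewrite (big_nat_widen _ _ n) // big_mkord cardsE -sum1_card.
rewrite big_mkcond [RHS]big_mkcond; apply: eq_bigr => j _.
by rewrite unfold_in /= rE; case: (j < i)%N => //=; case: eqP.
Qed.

Lemma tcol_tab i : tcol tab i = c (rho i) i.
Proof.
rewrite /tcol ffunE /= inordK // ltnS.
by apply: leq_trans (rowlen_le _ _) _; rewrite -ltnS.
Qed.

Lemma trow_tab i : trow tab i = rho i.
Proof. by rewrite /trow ffunE. Qed.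

Lemma nth_shape g : nth 0%N (parts shape) g = c g n.
Proof.
have [hg|hg] := ltnP g n.
  rewrite /parts (nth_map ord0) ?size_tuple //.
  rewrite -[g]/(nat_of_ord (Ordinal hg)) -tnth_nth tnth_mktuple inordK //.
  by rewrite ltnS rowlen_le.
rewrite nth_default; last by rewrite size_map size_tuple.
apply/esym/eqP; rewrite -leqn0 leqNgt; apply/negP => /rowlen_onto[i _ [hi _]].
by have := r_lt i; rewrite hi ltnNge hg.
Qed.

Lemma shapeE : parts shape = [seq c g n | g <- iota 0 n].
Proof.
apply: (@eq_from_nth _ 0%N); first by rewrite !size_map size_iota -enumT size_enum_ord.
move=> i; rewrite !size_map -enumT size_enum_ord => hi.
by rewrite nth_shape (nth_map 0%N) ?size_iota // nth_iota.
Qed.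

Lemma rowlen_anti i g : fits -> (i <= n)%N -> (c g.+1 i <= c g i)%N.
Proof.
move=> hf; elim: i => // i IH hi; rewrite !rowlenS.
have {}IH := IH (ltnW hi).
have [hr|_] := eqVneq (r i) g.+1; last by rewrite add0n (leq_trans IH) ?leq_addl.
have := hf (Ordinal hi) g; rewrite -rE /= => /(_ hr) h.
rewrite add1n (leq_trans _ (leq_addl _ _)) //; apply: leq_trans h _.
by apply: rowlen_mono; exact: (e_le he (Ordinal hi)).
Qed.

Lemma rowlen_anti_le i g h : fits -> (i <= n)%N -> (g <= h)%N -> (c h i <= c g i)%N.
Proof.
move=> hf hi; elim: h => [|h IH]; first by rewrite leqn0 => /eqP ->.
rewrite leq_eqVlt => /orP[/eqP-> //|/IH]; apply: leq_trans.
exact: rowlen_anti.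
Qed.

Lemma fits_column (i j : 'I_n) : fits -> c (rho i) i = c (rho j) j ->
  (rho i < rho j)%N -> (i < j)%N.
Proof.
move=> hf hc hr; have := rowlen_anti_le hf (ltn_ord j) (ltnW hr).
rewrite !rowlenS rE eqxx (gtn_eqF hr) add0n add1n -hc => h.
by rewrite ltnNge; apply/negP => /(rowlen_mono (rho i)); rewrite leqNgt h.
Qed.

(** If k stood above j in one column, the cell just below k, and with it the cell of j, would have
    been filled before e k. *)
Lemma fits_window (j k : 'I_n) : fits -> (e k <= j)%N -> (j < k)%N ->
  c (rho j) j != c (rho k) k.
Proof.
move=> hf hj hk; apply/eqP => hc.
have [hr|hr|hr] := ltngtP (rho j) (rho k).
- have [g hg] : exists g, rho k = g.+1 :> nat by case: (nat_of_ord (rho k)) hr => // g; exists g.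
  have := hf k g hg; rewrite -hg -hc => h.
  have h1 : (c g (e k) <= c (rho j) (e k))%N.
    by apply: rowlen_anti_le => //; [exact: ltnW|rewrite -ltnS -hg].
  by have := leq_trans h h1; rewrite ltnNge rowlen_mono.
- by have := fits_column hf (esym hc) hr; rewrite ltnNge ltnW.
have h := @rowlen_inj j k; rewrite !rE in h.
by rewrite (h hr hc) ltnn in hk.
Qed.

Lemma fits_is_partition : fits -> is_partition shape.
Proof.
move=> hf; apply/andP; split.
  rewrite shapeE; apply/(sortedP 0%N) => i; rewrite size_map size_iota => hi.
  rewrite !(nth_map 0%N) ?size_iota ?(ltnW hi) // !nth_iota ?(ltnW hi) //.
  exact: rowlen_anti.
rewrite shapeE sumnE big_map -[iota 0 n]/(index_iota 0 n) big_mkord.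
rewrite /c; under eq_bigr => g _ do rewrite count_word.
rewrite exchange_big /=.
rewrite (eq_bigr (fun _ => 1%N)); first by rewrite sum1_card card_ord.
move=> j _; rewrite (bigD1 (Ordinal (r_lt j))) //= eqxx big1 // => g.
by rewrite -val_eqE /= eq_sym => /negPf ->.
Qed.

Lemma fits_is_SYTe : fits -> is_SYTe e (parts shape) tab.
Proof.
move=> hf; apply/andP; split.
  apply/and4P; split.
  - apply/injectiveP => i j h; apply: val_inj; apply: (@rowlen_inj i j).
      by rewrite !rE -!trow_tab /trow h.
    by rewrite !rE -!tcol_tab /tcol h.
  - apply/eqP/setP => -[g x]; rewrite inE /= nth_shape; apply/imsetP/idP.
      case=> i _ h; have -> : (g : nat) = rho i by rewrite -trow_tab /trow -h.
      have -> : (x : nat) = c (rho i) i by rewrite -tcol_tab /tcol -h.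
      by apply: rowlen_lt; rewrite ?rE.
    move=> /rowlen_onto[i hi [hr hx]]; exists (Ordinal hi) => //.
    have hg : rho (Ordinal hi) = g by apply: val_inj; rewrite -[LHS]rE.
    rewrite ffunE hg; congr (_, _); apply: val_inj; rewrite /= inordK hx //.
  - apply/forallP => i; apply/forallP => j; apply/implyP => /andP[/eqP].
    rewrite !trow_tab !tcol_tab => hr hc; rewrite ltnNge; apply/negP => hji.
    by move: hc; rewrite hr ltnNge rowlen_mono.
  apply/forallP => i; apply/forallP => j; apply/implyP => /andP[/eqP].
  by rewrite !trow_tab !tcol_tab => hc hr; exact: fits_column.
apply/forallP => i; apply/forallP => j; apply/forallP => k; apply/implyP.
case/and3P=> hj hk; rewrite !tcol_tab.
wlog hjk : j k hj hk / (j < k)%N => [hw hne|_].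
  have [h|h|/val_inj h] := ltngtP j k; first exact: hw.
    by rewrite eq_sym; apply: hw; rewrite // eq_sym.
  by rewrite h eqxx in hne.
apply: fits_window => //.
have hki : (k <= i)%N by case/orP: hk => [/andP[_ /ltnW]//|/eqP ->].
apply: leq_trans (he.1 _ _ hki) _.
case/orP: hj => [/andP[]//|/eqP hji].
by move: hjk; rewrite hji ltnNge hki.
Qed.

(** As the shape is a partition, there is an entry j just below i, and j < i. It shares the column
    of i, so the strip condition keeps it out of the window, that is, j < e i. *)
Lemma SYTe_fits : is_partition shape -> is_SYTe e (parts shape) tab -> fits.
Proof.
case/andP=> hsort _ /andP[/and4P[_ _ _ hcol] hstrip] i g hg.
have hx : (c g.+1 i < c g n)%N.
  apply: (@leq_trans (c g.+1 n)); first by apply: rowlen_lt; rewrite ?rE.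
  rewrite -!nth_shape; have hgn : (g.+1 < n)%N by rewrite -hg.
  move/(sortedP 0%N): hsort; apply.
  by rewrite size_map size_tuple.
have [j hjn [hrj hcj]] := rowlen_onto hx; pose j0 := Ordinal hjn.
have hrj0 : rho j0 = g :> nat by rewrite -[LHS](rE j0).
have hc0 : tcol tab j0 = tcol tab i by rewrite !tcol_tab hrj0 hg.
have hji : (j < i)%N.
  move/forallP: hcol => /(_ j0)/forallP/(_ i)/implyP; apply.
  by rewrite hc0 eqxx !trow_tab hrj0 hg /=.
suff hje : (j < e i)%N by rewrite -hcj; apply: rowlen_lt.
rewrite ltnNge; apply/negP => hej.
move/forallP: hstrip => /(_ i)/forallP/(_ j0)/forallP/(_ i)/implyP.
rewrite hc0 eqxx /preceq /prec /= ltnS hej hji eqxx orbT /= => h.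
by have := h; rewrite -val_eqE /= (ltn_eqF hji) => /(_ isT).
Qed.

End Rows.

Lemma card_ord_ltn (m y : nat) : (y <= m)%N -> #|[set x : 'I_m | (x < y)%N]| = y.
Proof.
move=> hy; rewrite cardsE -sum1_card (eq_bigl (fun x : 'I_m => x < y)%N) //.
by rewrite -(big_ord_widen _ (fun _ => 1%N) hy) sum1_card card_ord.
Qed.

Definition rows (T : {ffun 'I_n -> 'I_n * 'I_n}) : {ffun 'I_n -> 'I_n} :=
  [ffun i => (T i).1].

Lemma rows_tab rho : rows (tab rho) = rho.
Proof. by apply/ffunP => i; rewrite !ffunE. Qed.

Lemma card_row_initial (lam : n.-tuple 'I_n.+1) T (g : 'I_n) y :
  is_SYT (parts lam) T -> (y <= nth 0 (parts lam) g)%N ->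
  #|[set j | (rows T j == g) && (tcol T j < y)%N]| = y.
Proof.
case/and4P=> /injectiveP hinj /eqP himg _ _ hy.
have hlam : (nth 0 (parts lam) g <= n)%N.
  by rewrite /parts (nth_map ord0) ?size_tuple // -ltnS.
rewrite -[RHS](@card_ord_ltn n) ?(leq_trans hy) //.
rewrite -(card_in_imset (f := fun j => (T j).2)); last first.
  move=> j j'; rewrite !inE !ffunE => /andP[/eqP h1 _] /andP[/eqP h2 _] h3.
  by apply: hinj; rewrite [T j]surjective_pairing [T j']surjective_pairing h1 h2 h3.
congr #|pred_of_set _|; apply/setP => x; rewrite inE; apply/imsetP/idP.
  by case=> j; rewrite inE => /andP[_ h] ->.
move=> hx; have : (g, x) \in [set T i | i : 'I_n].
  by rewrite himg inE /=; apply: leq_trans hx hy.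
case/imsetP=> j _ hj; exists j; last by rewrite -hj.
by rewrite inE ffunE /tcol -hj /= eqxx.
Qed.

(** In a standard tableau the entries < i in the row of i are exactly those to its left, so the rows
    determine the columns. *)
Lemma tab_rows (lam : n.-tuple 'I_n.+1) T :
  is_SYT (parts lam) T -> tab (rows T) = T /\ shape (rows T) = lam.
Proof.
move=> hT; have := hT; case/and4P=> /injectiveP hinj /eqP himg /forallP hrow _.
have hcell i : (tcol T i < nth 0 (parts lam) (rows T i))%N.
  have : T i \in [set T i | i : 'I_n] by apply: imset_f.
  by rewrite himg inE ffunE.
split.
  apply/ffunP => i; rewrite ffunE [RHS]surjective_pairing; congr (_, _).
    by rewrite ffunE.
  apply: val_inj; rewrite /= inordK; last first.
    by rewrite ltnS; apply: leq_trans (rowlen_le _ _ _) _; rewrite -ltnS.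
  rewrite rowlen_card; last exact: ltnW.
  rewrite -[RHS](@card_row_initial lam T (rows T i) (tcol T i) hT (ltnW (hcell i))).
  apply: eq_card => j; rewrite !inE val_eqE andbC; apply: andb_id2l => /eqP hji.
  have hij : trow T j = trow T i by move: hji; rewrite !ffunE /trow => ->.
  apply/idP/idP => h; last first.
    by have /forallP/(_ i)/implyP := hrow j; apply; rewrite hij eqxx.
  rewrite ltnNge; apply/negP; rewrite leq_eqVlt => /orP[/eqP hc|hc].
    suff e1 : i = j by rewrite e1 ltnn in h.
    apply: hinj; rewrite [T i]surjective_pairing [T j]surjective_pairing.
    by congr (_, _); apply: val_inj.
  have /forallP/(_ j)/implyP := hrow i; rewrite hij eqxx hc => /(_ isT).
  by rewrite ltnNge ltnW.
apply: eq_from_tnth => g; rewrite tnth_mktuple; apply: val_inj; rewrite /= inordK; last first.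
  by rewrite ltnS rowlen_le.
rewrite rowlen_card //.
have -> : (tnth lam g : nat) = nth 0%N (parts lam) g.
  by rewrite /parts (nth_map ord0) ?size_tuple // -tnth_nth.
rewrite -[RHS](@card_row_initial lam T g _ hT (leqnn _)).
apply: eq_card => j; rewrite !inE ltn_ord /= val_eqE.
by case: eqP => // <-; rewrite hcell.
Qed.

Lemma sum_tableaux (R : nmodType) (F : n.-tuple 'I_n.+1 -> {ffun 'I_n -> 'I_n * 'I_n} -> R) :
  \sum_(lam : n.-tuple 'I_n.+1 | is_partition lam)
    \sum_(T : {ffun 'I_n -> 'I_n * 'I_n} | is_SYTe e (parts lam) T) F lam T =
  \sum_(rho | is_partition (shape rho) && is_SYTe e (parts (shape rho)) (tab rho))
    F (shape rho) (tab rho).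
Proof.
rewrite pair_big_dep /=.
rewrite (reindex_onto (fun rho => (shape rho, tab rho)) (fun p => rows p.2)) /=.
  by apply: eq_bigl => rho; rewrite rows_tab eqxx andbT.
move=> [lam T] /= /andP[_ /andP[hT _]].
by have [-> ->] := tab_rows hT.
Qed.

Section Weight.
Variable rho : {ffun 'I_n -> 'I_n}.
Let r := extend rho.
Local Notation c := (rowlen rho).
Hypothesis hfit : fits rho.

Lemma sh_lt_tab i g : sh_lt (tab rho) i g = c g i.
Proof.
rewrite rowlen_card ?(ltnW (ltn_ord i)) // /sh_lt; apply: eq_card => j.
by rewrite !inE trow_tab.
Qed.

Lemma card_prec_below (i : 'I_n) g : rho i = g.+1 :> nat ->
  (#|prec_below e (tab rho) i| + c g (e i))%N = c g i.
Proof.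
move=> hg.
have -> : #|prec_below e (tab rho) i| = count_mem g (take (kfun e i) (word r i)).
  rewrite count_window //; apply: eq_card => j.
  by rewrite !inE !trow_tab hg eqSS /= -rE.
have -> : c g (e i) = count_mem g (drop (kfun e i) (word r i)).
  by rewrite kfunE drop_word // (e_le he).
by rewrite -count_cat cat_take_drop.
Qed.

(** Row g is filled from the left: its entries older than the window occupy the first [c g (e i)]
    columns, and the window starts right after them. *)
Lemma stat_L_tab (i : 'I_n) g : rho i = g.+1 :> nat ->
  prec_below e (tab rho) i != set0 -> stat_L e (tab rho) i = c g (e i).
Proof.
move=> hg hne; have hlt : (c g (e i) < c g i)%N.
  by rewrite -(card_prec_below hg) -[X in (X < _)%N]add0n ltn_add2r card_gt0.
have [j hji [hrj hcj]] := rowlen_onto hlt.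
pose j0 := Ordinal (ltn_trans hji (ltn_ord i)).
have hej : (e i <= j)%N.
  by rewrite leqNgt; apply/negP => /rowlen_lt/(_ hrj); rewrite hcj ltnn.
have hj0 : j0 \in prec_below e (tab rho) i.
  by rewrite inE /prec /= ltnS hej hji trow_tab trow_tab hg -[rho j0 : nat]rE /= hrj.
have hrj0 : rho j0 = g :> nat by rewrite -[LHS]rE.
apply/eqP; rewrite eqn_leq; apply/andP; split.
  rewrite -hcj -hrj0 -(tcol_tab rho j0) /stat_L.
  by apply: bigmin_leq => //; exact: mem_index_enum.
rewrite /stat_L; apply: (big_ind (fun x => c g (e i) <= x)%N) => [|x y hx hy|k].
- by apply: leq_trans (rowlen_le _ _ _) _; exact: ltnW.
- by rewrite leq_min hx.
rewrite inE !trow_tab hg eqSS => /andP[/andP[hek _] /eqP hk].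
by rewrite tcol_tab hk; apply: rowlen_mono.
Qed.

Variables (K : fieldType) (q : K).
Hypotheses (q_neq0 : q != 0) (q_neq1 : q != 1).

Lemma qint_nat m : qint q m%:Z = \sum_(k < m) q ^+ k.
Proof. by rewrite /qint -exprnP subrX1 mulrAC mulfV ?mul1r // subr_eq0. Qed.

Lemma qVint_qint (m : nat) : qVint q m = q ^ (1 - m%:Z) * qint q m%:Z.
Proof.
rewrite qint_nat /qVint; case: m => [|m]; first by rewrite !big_ord0 mulr0.
rewrite [LHS](reindex_inj rev_ord_inj) /= mulr_sumr; apply: eq_bigr => k _.
have -> : (1 - m.+1%:Z) = - m%:Z :> int by lia.
rewrite -exprz_inv -exprnP /= subSS.
have hk : (k <= m)%N by rewrite -ltnS.
by rewrite -{3}(subnK hk) exprD -mulrA -exprMn mulVf // expr1n mulr1.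
Qed.

(** Both q-numbers of the statement have the argument [c g (e i) - c g.+1 i] for [rho i = g.+1]:
    without window entries in row g, [c g (e i) = c g i]. The 0 passed to [nfree_heights] in place
    of N matters only in row 0, excluded here. *)
Lemma tab_weightE :
  tab_weight e q (tab rho) = \prod_(i < n | (0 < rho i)%N)
    (q ^ (- (stat_m e (tab rho) i)%:Z - stat_d (tab rho) i) *
     qint q (nfree_heights 0 (kfun e i) (word r i) (rho i))%:Z).
Proof.
rewrite /tab_weight [RHS]big_split /= -mulrA.
rewrite (eq_bigl (fun i => 0 < rho i)%N); last by move=> i; rewrite trow_tab.
congr (_ * _).
rewrite [RHS](bigID (fun i => prec_below e (tab rho) i == set0)) /=.
congr (_ * _); apply: eq_big => [i|i]; rewrite ?trow_tab // => /andP[hi hs].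
  case hg : (rho i : nat) hi => [//|g] _; rewrite /stat_d !trow_tab !sh_lt_tab hg /=.
  rewrite /nfree_heights /= kfunE drop_word ?(e_le he) // -/(c g (e i)) -/(c g.+1 i).
  have := card_prec_below hg; rewrite (eqP hs) cards0 add0n => ->.
  by rewrite -subzn //; apply: rowlen_anti => //; exact: ltnW.
case hg : (rho i : nat) hi => [//|g] _; rewrite ?trow_tab !sh_lt_tab ?hg.
rewrite (stat_L_tab hg hs) /nfree_heights /= kfunE drop_word ?(e_le he) // -/(c g (e i)) -/(c g.+1 i).
by rewrite subzn // ltnW // hfit.
Qed.

(** The exponent binom(n+1,2) - |e| is the sum over i of 1 plus the window size. In row g+1,
    subtracting m and d leaves the window entries above row g plus 1 - f, f being the number of free
    columns: q^(1-f) converts [f] at 1/q into [f] at q. In row 0 the whole window counts, and the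
    extra q is offset by the q^-1 of the last product. *)
Lemma word_weight_tab N :
  word_weight q N (kfun e) (word r n) =
  q ^ ('C(n.+1, 2)%:Z - (hsize e)%:Z) * tab_weight e q (tab rho) *
  \prod_(l < c 0 n) (q^-1 * qVint q (N - l)).
Proof.
rewrite word_weight_word tab_weightE.
have hexp : q ^ ('C(n.+1, 2)%:Z - (hsize e)%:Z) = \prod_(i < n) q ^ ((kfun e i).+1%:Z).
  rewrite -(big_morph (fun z => q ^ z) (fun x y => expfzDr x y q_neq0) (expr0z q)).
  congr (q ^ _); rewrite -triangular_sum /hsize big_mkord big_ord_recl add0n.
  rewrite !(big_morph Posz PoszD erefl) -sumrB; apply: eq_bigr => i _.
  by rewrite kfunE /= /bump leq0n; have := e_le he i; lia.
(* The bottom-row entry in column l finds N - l empty columns. *)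
have hzero : \prod_(l < c 0 n) (q^-1 * qVint q (N - l)) =
    \prod_(i < n | rho i == 0 :> nat) (q^-1 * qVint q (N - c 0 i)).
  have h m : (m <= n)%N -> \prod_(l < c 0 m) (q^-1 * qVint q (N - l)) =
     \prod_(i < m | r i == 0) (q^-1 * qVint q (N - c 0 i)).
    elim: m => [_|m IH hm]; first by rewrite !big_ord0.
    rewrite [RHS]big_mkcond big_ord_recr /= -big_mkcond -IH ?(ltnW hm) // rowlenS.
    by case: eqP => _; [rewrite add1n big_ord_recr|rewrite add0n mulr1].
  by rewrite h //; apply: eq_bigl => i; rewrite /r rE.
rewrite hexp hzero [X in _ * X * _]big_mkcond [X in _ = _ * X]big_mkcond -!big_split /=.
apply: eq_bigr => i _; rewrite /r rE -/r.
have hA : count (fun b => rho i < b)%N (map S (take (kfun e i) (word r i))) =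
   #|[set j : 'I_n | prec e j i & (rho i < (rho j).+1)%N]|.
  rewrite count_map count_window //; apply: eq_card => j.
  by rewrite !inE /r rE.
rewrite hA; case hg : (rho i : nat) => [|g] /=.
  have -> : #|[set j : 'I_n | prec e j i & (0 < (rho j).+1)%N]| = kfun e i.
    have := count_window he predT r i; rewrite count_predT size_takel; last first.
      by rewrite size_word kfunE leq_subr.
    by move=> ->; apply: eq_card => j; rewrite !inE andbT.
  by rewrite mulr1 /nfree_heights /= -/(c 0 i) -exprnP exprSr mulrA mulfK.
have hm : nfree_heights N (kfun e i) (word r i) g.+1 = (c g (e i) - c g.+1 i)%N.
  by rewrite /nfree_heights /= kfunE drop_word ?(e_le he).
have hm0 : nfree_heights 0 (kfun e i) (word r i) g.+1 = (c g (e i) - c g.+1 i)%N.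
  by rewrite /nfree_heights /= kfunE drop_word ?(e_le he).
have hlt : (c g.+1 i < c g (e i))%N by exact: hfit.
rewrite mulr1 hm hm0 qVint_qint !mulrA [q ^+ #|_|]exprnP -!expfzDr //.
congr (q ^ _ * _ * _).
have hcount s : (count (fun b => g < b) s + count (fun b => b < g) s + count_mem g s =
    size s)%N.
  by elim: s => //= b s <-; case: (ltngtP b g) => _ /=; lia.
have := hcount (take (kfun e i) (word r i)).
rewrite size_takel; last by rewrite size_word kfunE leq_subr.
have -> : count (fun b => g < b)%N (take (kfun e i) (word r i)) =
    #|[set j : 'I_n | prec e j i & (g.+1 < (rho j).+1)%N]|.
  by rewrite count_window //; apply: eq_card => j; rewrite !inE /r rE.
have -> : count (fun b => b < g)%N (take (kfun e i) (word r i)) = stat_m e (tab rho) i.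
  rewrite count_window //; apply: eq_card => j.
  by rewrite !inE !trow_tab /r rE hg.
have := card_prec_below hg.
have -> : #|prec_below e (tab rho) i| = count_mem g (take (kfun e i) (word r i)).
  rewrite count_window //; apply: eq_card => j.
  by rewrite !inE !trow_tab hg eqSS /= /r rE.
rewrite /stat_d !trow_tab !sh_lt_tab hg /=.
move: (stat_m _ _ _) (count_mem _ _) => ms pb.
by move: #|_| (c g i) hlt => A cgi; lia.
Qed.

End Weight.
End Tableau.

(** * Conjugate partitions *)

Lemma leq_inj x y : (forall a, (x <= a)%N = (y <= a)%N) -> x = y.
Proof. by move=> h; apply/eqP; rewrite eqn_leq h leqnn -h leqnn. Qed.

Lemma count_gt_leq s j a : sorted geq s ->
  (count (fun x => j < x)%N s <= a)%N = (nth 0%N s a <= j)%N.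
Proof.
elim: s a => [|x s IH] a hs; first by rewrite nth_nil.
have hall : all (fun y => y <= x)%N s.
  apply: order_path_min hs => u v w; rewrite /geq /= => h1 h2; exact: leq_trans h1.
have hcount : (x <= j)%N -> count (fun y => j < y)%N s = 0%N.
  move=> hx; apply/eqP; rewrite -leqn0 leqNgt -has_count -all_predC.
  by apply: sub_all hall => y /= hy; rewrite -leqNgt (leq_trans hy).
case: a => [|a] /=.
  have [hx|hx] := leqP x j; first by rewrite add0n hcount.
  by rewrite add1n.
rewrite -IH ?(path_sorted hs) //.
by have [hx|hx] := leqP x j; [rewrite add0n hcount|rewrite add1n ltnS].
Qed.

Lemma nth_conj_part s j : sorted geq s ->
  nth 0%N (conj_part s) j = count (fun x => j < x)%N s.
Proof.
move=> hs; rewrite /conj_part; have [hj|hj] := ltnP j (head 0%N s).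
  by rewrite (nth_map 0%N) ?size_iota // nth_iota.
rewrite nth_default ?size_map ?size_iota //; apply/esym/eqP.
by rewrite -leqn0 count_gt_leq // nth0.
Qed.

Lemma size_conj_part s : size (conj_part s) = head 0%N s.
Proof. by rewrite /conj_part size_map size_iota. Qed.

Lemma sum_mult mu : all (fun x => (0 < x <= head 0 mu)%N) mu ->
  (\sum_(1 <= i < (head 0 mu).+1) mult mu i)%N = size mu.
Proof.
rewrite /mult; move: (head _ _) => h hall.
transitivity (\sum_(x <- mu) 1)%N; last by rewrite big_const_seq count_predT iter_addn_0 mul1n.
rewrite (eq_bigr (fun i => \sum_(x <- mu) (x == i))%N) => [|i _]; last first.
  by rewrite -sum1_count big_mkcond; apply: eq_bigr => x _ /=; case: eqP.
rewrite exchange_big /=; apply: eq_big_seq => x /(allP hall) /andP[h0 hx].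
rewrite (bigD1_seq x) /= ?eqxx ?iota_uniq ?mem_index_iota ?h0 ?ltnS //.
by rewrite big1 // => i /negPf; rewrite eq_sym => ->.
Qed.

(** * The Hall-Littlewood normalization *)

Section Scalars.
Variables (K : fieldType) (q : K).
Hypothesis q_neq0 : q != 0.
Hypothesis q_free : forall m, (0 < m)%N -> q ^+ m != 1.

Lemma qV_free m : (0 < m)%N -> 1 - q^-1 ^+ m != 0.
Proof.
move=> hm; rewrite subr_eq0 eq_sym exprVn -(inj_eq invr_inj) invrK invr1.
exact: q_free.
Qed.

Lemma qVintE m : qVint q m = (1 - q^-1 ^+ m) / (1 - q^-1).
Proof.
have h1 : 1 - q^-1 != 0 by rewrite -[X in 1 - X]expr1 qV_free.
rewrite -opprB subrX1 -mulNr opprB mulrAC mulfV ?mul1r //.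
Qed.

Lemma qVint_neq0 m : qVint q m.+1 != 0.
Proof.
have h1 : 1 - q^-1 != 0 by rewrite -[X in 1 - X]expr1 qV_free.
by rewrite qVintE mulf_neq0 ?invr_neq0 ?qV_free.
Qed.

Lemma HL_vmE m : HL_vm m q^-1 = \prod_(d < m) qVint q d.+1.
Proof.
rewrite /HL_vm big_add1 /= big_mkord; apply: eq_bigr => d _.
by rewrite qVintE.
Qed.

Lemma HL_vm_neq0 m : HL_vm m q^-1 != 0.
Proof. by rewrite HL_vmE; apply/prodf_neq0 => d _; exact: qVint_neq0. Qed.

(** For each part i > 0 of multiplicity m, the factor of b is (1-t)^m times that of v; only the
    factor of v for the part 0 survives. *)
Lemma HL_bv N mu : all (fun x => (0 < x <= head 0 mu)%N) mu ->
  HL_b mu q^-1 / HL_v N mu q^-1 =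
  (1 - q^-1) ^+ size mu / \prod_(d < N - size mu) qVint q d.+1.
Proof.
move=> hall; have h1 : 1 - q^-1 != 0 by rewrite -[X in 1 - X]expr1 qV_free.
rewrite /HL_v HL_vmE /HL_b.
have -> : \prod_(1 <= i < (head 0 mu).+1) \prod_(1 <= k < (mult mu i).+1) (1 - q^-1 ^+ k) =
   (1 - q^-1) ^+ size mu * \prod_(1 <= i < (head 0%N mu).+1) HL_vm (mult mu i) q^-1.
  rewrite -(sum_mult hall) expr_sum -big_split; apply: eq_bigr => i _ /=.
  rewrite /HL_vm -[X in (1 - q^-1) ^+ X]/(mult mu i).
  rewrite !big_add1 /= !big_mkord prodf_div prodr_const card_ord.
  by rewrite mulrCA mulfV ?mulr1 // expf_neq0.
set v := \prod_(1 <= i < _) _; have hv : v != 0.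
  by rewrite /v prodf_seq_neq0; apply/allP => i _; rewrite HL_vm_neq0 implybT.
have hp : \prod_(d < N - size mu) qVint q d.+1 != 0.
  by apply/prodf_neq0 => d _; exact: qVint_neq0.
by field; rewrite hv hp.
Qed.

(** Reversing each sum, [d+1] at q is q^d times [d+1] at 1/q. *)
Lemma qfact_prod N : qfact q N * \prod_(d < N) q^-1 ^+ d = \prod_(d < N) qVint q d.+1.
Proof.
rewrite /qfact -big_split; apply: eq_bigr => d _ /=; rewrite /qVint mulr_suml.
rewrite [LHS](reindex_inj rev_ord_inj) /=; apply: eq_bigr => r _.
have hr : (r <= d)%N by rewrite -ltnS.
have -> : q^-1 ^+ d = q^-1 ^+ (d - r) * q^-1 ^+ r by rewrite -exprD subnK.
by rewrite subSS mulrA -exprMn mulfV // expr1n mul1r.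
Qed.

Lemma qVint_prod N l : (l <= N)%N ->
  \prod_(d < N) qVint q d.+1 = \prod_(k < l) qVint q (N - k) * \prod_(d < N - l) qVint q d.+1.
Proof.
elim: l => [|l IH] hl; first by rewrite big_ord0 mul1r subn0.
rewrite (IH (ltnW hl)) big_ord_recr /= -mulrA; congr (_ * _).
by have -> : (N - l = (N - l.+1).+1)%N by [lia]; rewrite big_ord_recr /= mulrC.
Qed.

(** Here [size mu] is lambda_1. The bottom-row q-numbers complete [N - lambda_1]! to [N]! at 1/q,
    and 1 - 1/q = (q-1)/q accounts for the denominator; the product of the q^-d is the constant of
    [HL_R_kernel]. *)
Lemma scalar_identity N mu (x tw : K) : (size mu <= N)%N ->
  all (fun x => (0 < x <= head 0 mu)%N) mu ->
  x * tw * \prod_(l < size mu) (q^-1 * qVint q (N - l)) =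
  qfact q N * (HL_b mu q^-1 * (HL_v N mu q^-1)^-1 * \prod_(d < N) q^-1 ^+ d *
    (x / (q - 1) ^+ size mu * tw)).
Proof.
move=> hN hall; have h1 : q - 1 != 0 by rewrite subr_eq0 -[q]expr1 q_free.
have -> : qfact q N * (HL_b mu q^-1 * (HL_v N mu q^-1)^-1 * \prod_(d < N) q^-1 ^+ d *
    (x / (q - 1) ^+ size mu * tw)) = (qfact q N * \prod_(d < N) q^-1 ^+ d) *
    (HL_b mu q^-1 / HL_v N mu q^-1) * (x / (q - 1) ^+ size mu * tw) by ring.
rewrite qfact_prod HL_bv // (qVint_prod hN) big_split /= prodr_const card_ord.
have -> : 1 - q^-1 = q^-1 * (q - 1) by rewrite mulrBr mulVf // mulr1.
rewrite exprMn; set p := \prod_(d < N - _) _; have hp : p != 0.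
  by apply/prodf_neq0 => d _; exact: qVint_neq0.
have h2 : (q - 1) ^+ size mu != 0 by rewrite expf_neq0.
by set y := (q - 1) ^+ _ in h2 *; set z := _ ^+ _; field; rewrite hp h2.
Qed.

End Scalars.

Lemma ratio_flip (F : fieldType) (x y s : F) : s != 0 -> x - y != 0 -> y - x != 0 ->
  (y - s^-1 * x) / (y - x) = s^-1 * ((x - s * y) / (x - y)).
Proof. by move=> h1 h2 h3; field; rewrite h1 h2 h3. Qed.

(** * Scalars and variables in the fraction field *)

Section Fraction.
Variables (K : fieldType) (N : nat).

Definition scal_morph : {rmorphism K -> {fraction {mpoly K[N]}}} :=
  (@tofrac {mpoly K[N]} \o @mpolyC N K)%FUN.

Lemma scalE c : scal N c = scal_morph c.
Proof. by []. Qed.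

Lemma xvar_inj : injective (@xvar K N).
Proof.
move=> i j /eqP; rewrite /xvar tofrac_eq => /eqP /(congr1 (mcoeff U_(i)%MM)).
rewrite !mcoeffXU eqxx; case: eqP => [-> //|_] /eqP.
by rewrite oner_eq0.
Qed.

Lemma xvar_neq0 i : xvar K i != 0 :> {fraction {mpoly K[N]}}.
Proof.
rewrite /xvar tofrac_eq0; apply/eqP => /(congr1 (mcoeff U_(i)%MM)).
by rewrite mcoeffXU eqxx mcoeff0 => /eqP; rewrite oner_eq0.
Qed.

Lemma scal_xvar_neq c i j : i != j -> scal N c * xvar K i != xvar K j.
Proof.
move=> hij; rewrite /scal /xvar -tofracM tofrac_eq mul_mpolyC.
apply/eqP => /(congr1 (mcoeff U_(j)%MM)).
rewrite mcoeffZ !mcoeffXU eqxx (negPf hij) mulr0 => /eqP.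
by rewrite eq_sym oner_eq0.
Qed.

(** Reversing the variables turns each factor at 1/q into q^-1 times a kernel factor ([ratio_flip]),
    once per pair, whence q^(-N(N-1)/2); it also reverses the exponents. *)
Lemma HL_R_kernel mu (q : K) : q != 0 ->
  HL_R N mu q^-1 = scal N (\prod_(d < N) q^-1 ^+ d) *
   \sum_(w : 'S_N) (\prod_(j < N) xvar K (w j) ^+ nth 0%N mu (N.-1 - j)) *
      kernel (scal N q) (@xvar K N) w.
Proof.
move=> hq; pose rv : 'S_N := perm (@rev_ord_inj N).
have rvE i : rv i = rev_ord i by rewrite permE.
rewrite /HL_R (reindex_inj (mulgI rv)) /= mulr_sumr; apply: eq_bigr => w _.
rewrite mulrCA; congr (_ * _).
  rewrite (reindex_inj (@rev_ord_inj N)) /=; apply: eq_bigr => i _.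
  by rewrite permM rvE rev_ordK; congr (_ ^+ nth _ _ _); have := ltn_ord i; lia.
have hs0 : scal N q != 0 by rewrite scalE fmorph_eq0.
have -> : scal N (\prod_(d < N) q^-1 ^+ d) =
    \prod_(i < N) \prod_(j < N | (i < j)%N) (scal N q)^-1.
  rewrite (exchange_big_dep xpredT) //= scalE rmorph_prod; apply: eq_bigr => j _.
  rewrite rmorphXn fmorphV.
  rewrite -(big_ord_widen N (fun _ => (scal N q)^-1) (ltnW (ltn_ord j))).
  by rewrite prodr_const card_ord.
rewrite /kernel -big_split /=.
rewrite (reindex_inj (@rev_ord_inj N)) /=.
rewrite (eq_bigr (fun i : 'I_N => \prod_(j < N | (j < i)%N)
  ((xvar K (w i) - scal N q^-1 * xvar K (w j)) / (xvar K (w i) - xvar K (w j))))); last first.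
  move=> i _; rewrite (reindex_inj (@rev_ord_inj N)) /=; apply: eq_big => [j|j _].
    by have := ltn_ord i; have := ltn_ord j; lia.
  by rewrite !permM !rvE !rev_ordK.
rewrite (exchange_big_dep xpredT) //=; apply: eq_bigr => i _.
rewrite -big_split /=; apply: eq_bigr => j hij.
have hne (k l : 'I_N) : k != l -> xvar K (w k) - xvar K (w l) != 0.
  by rewrite subr_eq0; apply: contraNneq => /xvar_inj /perm_inj ->.
have h1 : xvar K (w i) - xvar K (w j) != 0 by apply: hne; rewrite -val_eqE ltn_eqF.
have h2 : xvar K (w j) - xvar K (w i) != 0 by apply: hne; rewrite -val_eqE gtn_eqF.
have -> : scal N q^-1 = (scal N q)^-1 by rewrite !scalE fmorphV.

exact (ratio_flip hs0 h1 h2).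
Qed.

Lemma word_weight_scal (q : K) m kf s : word_weight (scal N q) m kf s = scal N (word_weight q m kf s).
Proof.
have hqi l : qVint (scal N q) l = scal N (qVint q l).
  rewrite /qVint !scalE rmorph_sum; apply: eq_bigr => r _.
  by rewrite rmorphXn fmorphV.
elim: s => [|g s IH] /=; first by rewrite scalE rmorph1.
by rewrite IH hqi !scalE !rmorphM rmorphXn.
Qed.

Lemma qfact_scal (q : K) : qfact (scal N q) N = scal N (qfact q N).
Proof.
rewrite /qfact !scalE rmorph_prod; apply: eq_bigr => d _.
by rewrite rmorph_sum; apply: eq_bigr => r _; rewrite rmorphXn.
Qed.

End Fraction.

(** * Final column heights and the term of one tableau *)

Section Tableau.
Variables (n' : nat).
Let n := n'.+1.
Variables (e : 'I_n -> 'I_n).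
Hypothesis he : rev_hessenberg e.

(** The numbers of columns of heights 0, 1, 2, ... are N - c_0, c_0 - c_1, c_1 - c_2, ..., for the
    row lengths c_g; the sum telescopes. *)
Lemma count_free_lt (rho : {ffun 'I_n -> 'I_n}) N a : fits e rho ->
  (rowlen rho 0 n <= N)%N ->
  count (fun b => b < a.+1)%N (free_heights N 0 (word (extend rho) n)) = (N - rowlen rho a n)%N.
Proof.
move=> hf hN; have hall : all (fun r => r < size (word (extend rho) n))%N (word (extend rho) n).
  rewrite size_word; suff h m : (m <= n)%N -> all (fun r => r < n)%N (word (extend rho) m) by exact: h.
  elim: m => //= m IH hm; rewrite IH ?(ltnW hm) // andbT.
  by rewrite -[m]/(val (Ordinal hm)) extendE.
elim: a => [|a IH].
  rewrite (eq_count (a2 := pred1 0%N)) ?count_free // => x /=.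
  by rewrite ltnS leqn0.
rewrite (eq_count (a2 := predU (fun b => b < a.+1)%N (pred1 a.+1))); last first.
  by move=> x /=; rewrite ltnS leq_eqVlt orbC.
have hI := count_predUI (fun b => b < a.+1)%N (pred1 a.+1) (free_heights N 0 (word (extend rho) n)).
have h0 : count (predI (fun b => b < a.+1)%N (pred1 a.+1)) (free_heights N 0 (word (extend rho) n)) = 0%N.
  apply/eqP; rewrite -leqn0 leqNgt -has_count; apply/negP => /hasP[x _ /= /andP[h /eqP hx]].
  by rewrite hx ltnn in h.
rewrite h0 addn0 in hI; rewrite hI IH count_free //.
have -> : nfree_heights N 0 (word (extend rho) n) a.+1 = (rowlen rho a n - rowlen rho a.+1 n)%N.
  by rewrite /nfree_heights /supply drop0.
have h1 := rowlen_anti he a hf (leqnn n).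
have h2 := rowlen_anti_le he hf (leqnn n) (leq0n a).
by move: h1 h2 hN; lia.
Qed.

Lemma nth_sort_free (rho : {ffun 'I_n -> 'I_n}) N j : fits e rho ->
  (rowlen rho 0 n <= N)%N -> (j < N)%N ->
  nth 0%N (sort leq (free_heights N 0 (word (extend rho) n))) j =
  nth 0%N (conj_part (parts (shape rho))) (N.-1 - j).
Proof.
move=> hf hN hj; set t := sort _ _.
have ht : sorted leq t by apply: sort_sorted; exact: leq_total.
have hct a : count (fun b => b < a.+1)%N t = (N - rowlen rho a n)%N.
  by rewrite -(count_free_lt a hf hN); apply/seq.permP; rewrite perm_sort.
have hsz : (j < size t)%N.
  apply: leq_trans (count_size (fun b => b < n.+1)%N t); rewrite hct.
  have -> : rowlen rho n n = 0%N; last by rewrite subn0.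
  by rewrite -nth_shape nth_default // size_map size_tuple.
have hp : sorted geq (parts (shape rho)) by case/andP: (fits_is_partition he hf).
apply: leq_inj => a; rewrite nth_conj_part // count_gt_leq // nth_shape.
by rewrite -ltnS nth_lt_count // hct -/n; lia.
Qed.

Lemma head_shape (rho : {ffun 'I_n -> 'I_n}) : head 0%N (parts (shape rho)) = rowlen rho 0 n.
Proof. by rewrite -nth0 nth_shape. Qed.

Lemma all_conj_part s : sorted geq s ->
  all (fun x => 0 < x <= head 0 (conj_part s))%N (conj_part s).
Proof.
move=> hs; apply/(all_nthP 0%N) => j; rewrite size_conj_part => hj.
rewrite -nth0 !nth_conj_part //; apply/andP; split; last first.
  by apply: sub_count => x /=; exact: leq_ltn_trans.
by rewrite ltnNge count_gt_leq // nth0 -ltnNge.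
Qed.

Lemma tableau_term (K : fieldType) (q : K) N (rho : {ffun 'I_n -> 'I_n}) :
  q != 0 -> (forall m, (0 < m)%N -> q ^+ m != 1) -> fits e rho ->
  scal N (word_weight q N (kfun e) (word (extend rho) n)) *
  (\sum_(w : 'S_N) (\prod_(j < N) xvar K (w j) ^+
      nth 0%N (sort leq (free_heights N 0 (word (extend rho) n))) j) *
      kernel (scal N q) (@xvar K N) w) =
  scal N (qfact q N) * (HL_Q N (conj_part (parts (shape rho))) q^-1 *
    scal N (q ^ ('C(n.+1, 2)%:Z - (hsize e)%:Z) / (q - 1) ^+ head 0%N (parts (shape rho)) *
      tab_weight e q (tab rho))).
Proof.
move=> q0 hq hf; have q1 : q != 1 by rewrite -[q]expr1 hq.
rewrite (word_weight_tab he hf q0 q1) -head_shape -size_conj_part.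
set mu := conj_part _; rewrite /HL_Q /HL_P.
have hp : sorted geq (parts (shape rho)) by case/andP: (fits_is_partition he hf).
have hmu := all_conj_part hp; rewrite -/mu in hmu.
case: leqP => hN; last first.
  (* With lambda_1 > N the bottom-row factor l = N is [0] = 0, and Q vanishes as well. *)
  rewrite (bigD1 (Ordinal hN)) //= subnn /qVint big_ord0 mulr0 mul0r mulr0.
  by rewrite scalE rmorph0 !(mul0r, mulr0).
rewrite HL_R_kernel //.
rewrite (eq_bigr (fun w : 'S_N => (\prod_(j < N) xvar K (w j) ^+ nth 0%N mu (N.-1 - j)) *
   kernel (scal N q) (@xvar K N) w)); last first.
  move=> w _; congr (_ * _); apply: eq_bigr => j _.
  by rewrite nth_sort_free // -head_shape -size_conj_part.
set A := \sum_w _; rewrite (scalar_identity q0 hq _ _ hN hmu).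
have hs (x y : K) : scal N (x * y) = scal N x * scal N y by rewrite !scalE rmorphM.
rewrite (hs (qfact q N)) (hs (_ * _ * _)) (hs (_ / _)) (hs (HL_b _ _)).
by rewrite -[LHS]mulrA; congr (_ * _); rewrite mulrAC !mulrA.
Qed.

End Tableau.

(** * Specialization to the variable q and conclusion *)

Lemma qq_neq0 : qq != 0.
Proof. by rewrite /qq tofrac_eq0 polyX_eq0. Qed.

Lemma qq_free m : (0 < m)%N -> qq ^+ m != 1.
Proof.
move=> hm; rewrite /qq -tofracXn -tofrac1 tofrac_eq.
apply/eqP => /(congr1 (horner^~ 0)).
by rewrite hornerXn hornerC expr0n gtn_eqF //= => /eqP; rewrite eq_sym oner_eq0.
Qed.

Lemma qfact_neq0 (K : fieldType) (q : K) N :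
  q != 0 -> (forall m, (0 < m)%N -> q ^+ m != 1) -> qfact q N != 0.
Proof.
move=> q0 hq; apply/prodf_neq0 => d _.
by apply: contraNneq (hq d.+1 isT) => h; rewrite -subr_eq0 subrX1 h mulr0.
Qed.

Lemma chromatic_frac (K : fieldType) n (e : 'I_n -> 'I_n) N (q : K) :
  tofrac (chromatic e N q) =
  \sum_(kappa : {ffun 'I_n -> 'I_N})
    (if proper_coloring e kappa
     then scal N q ^+ asc e kappa * \prod_(v < n) xvar K (kappa v) else 0).
Proof.
rewrite /chromatic rmorph_sum big_mkcond /=; apply: eq_bigr => kappa _.
case: ifP => // _; rewrite -mul_mpolyC tofracM rmorph_prod; congr (_ * _).
by rewrite [LHS](_ : _ = scal N (q ^+ asc e kappa)) // !scalE rmorphXn.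
Qed.

Lemma HL_Q_small (K : fieldType) N mu (t : K) : (N < size mu)%N -> HL_Q N mu t = 0.
Proof. by move=> h; rewrite /HL_Q /HL_P leqNgt h mulr0. Qed.

Lemma word_weight_neq0_fits n' (e : 'I_n'.+1 -> 'I_n'.+1) (K : fieldType) (q : K) N rho :
  rev_hessenberg e -> word_weight q N (kfun e) (word (extend rho) n'.+1) != 0 -> fits e rho.
Proof.
move=> he; rewrite word_weight_word => /prodf_neq0 hW i g hg.
have := hW i isT; rewrite mulf_eq0 negb_or => /andP[_].
rewrite extendE hg /nfree_heights /= kfunE drop_word ?(e_le he) //.
rewrite -/(rowlen rho g (e i)) -/(rowlen rho g.+1 i) -subn_gt0.
by case: (_ - _)%N => //; rewrite /qVint big_ord0 eqxx.
Qed.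

Theorem theorem4p1 (n : nat) (hn : (1 <= n)%N) (e : 'I_n -> 'I_n)
    (he : rev_hessenberg e) (N : nat) :
  tofrac (chromatic e N qq) =
  \sum_(lam : n.-tuple 'I_n.+1 | is_partition lam)
    HL_Q N (conj_part (parts lam)) qq^-1 *
    scal N
      (qq ^ ('C(n.+1, 2)%:Z - (hsize e)%:Z) / (qq - 1) ^+ head 0%N (parts lam) *
       \sum_(T : {ffun 'I_n -> 'I_n * 'I_n} | is_SYTe e (parts lam) T)
         tab_weight e qq T).
Proof.
case: n hn e he => [//|n'] _ e he; set n := n'.+1 in e he *.
have q0 := qq_neq0; have hq := qq_free.
(* Without variables there is no coloring, as n >= 1, and lambda_1 > 0 makes every Q vanish. *)
case: N => [|N'].
  rewrite chromatic_frac big1 => [|kappa _]; last by case: (kappa ord0).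
  rewrite big1 // => lam /andP[hsort /eqP hlam]; rewrite HL_Q_small ?mul0r // size_conj_part.
  rewrite lt0n; apply: contraTneq isT => h0; move: hlam.
  rewrite (_ : sumn _ = 0%N) // sumnE big1_seq // => x /andP[_ hx].
  apply/eqP; rewrite -leqn0 leqNgt; apply/negP => hx0.
  have: (count (fun y => 0 < y) (parts lam) <= 0)%N by rewrite count_gt_leq // nth0 h0.
  by rewrite leqNgt -has_count => /hasP[]; exists x.
set N := N'.+1.
have s0 : scal N qq != 0 by rewrite scalE fmorph_eq0.
have s1 : scal N qq != 1.
  by rewrite scalE fmorph_eq1 -[qq]expr1 hq.
have hqf : scal N (qfact qq N) != 0 by rewrite scalE fmorph_eq0 qfact_neq0.
have hqf' : qfact (scal N qq) N != 0 by rewrite qfact_scal.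
have hgen (i j : 'I_N) : i != j -> scal N qq * xvar Qq i != xvar Qq j by exact: scal_xvar_neq.
have := coloring_expansion (@xvar_inj Qq N) s0 hgen (kfun0 e) (kfunS he) (kfunn e)
  (@xvar_neq0 Qq N) s1 hqf'.
rewrite sum_ffunE !sum_words_ffun qfact_scal.
rewrite [in LHS](eq_bigr (fun kappa : {ffun 'I_n -> 'I_N} =>
   if proper_coloring e kappa
   then scal N qq ^+ asc e kappa * \prod_(v < n) xvar Qq (kappa v) else 0)); last first.
  move=> kappa _; rewrite color_weight_word; apply: (@chromatic_words n e he _ N (scal N qq) (@xvar Qq N) (point (@xvar Qq N) 1%g)).
  by move=> k; rewrite /point ltn_ord perm1 inord_val.
rewrite -chromatic_frac => h; apply: (mulfI hqf); rewrite {}h.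
pose F (lam : n.-tuple 'I_n.+1) (T : {ffun 'I_n -> 'I_n * 'I_n}) :=
  HL_Q N (conj_part (parts lam)) qq^-1 *
  scal N (qq ^ ('C(n.+1, 2)%:Z - (hsize e)%:Z) / (qq - 1) ^+ head 0%N (parts lam) *
     tab_weight e qq T).
have -> : \sum_(lam : n.-tuple 'I_n.+1 | is_partition lam)
    HL_Q N (conj_part (parts lam)) qq^-1 *
    scal N (qq ^ ('C(n.+1, 2)%:Z - (hsize e)%:Z) / (qq - 1) ^+ head 0%N (parts lam) *
       \sum_(T : {ffun 'I_n -> 'I_n * 'I_n} | is_SYTe e (parts lam) T) tab_weight e qq T) =
  \sum_(lam : n.-tuple 'I_n.+1 | is_partition lam)
    \sum_(T : {ffun 'I_n -> 'I_n * 'I_n} | is_SYTe e (parts lam) T) F lam T.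
  by apply: eq_bigr => lam _; rewrite mulr_sumr scalE rmorph_sum mulr_sumr.
rewrite sum_tableaux mulr_sumr [RHS]big_mkcond; apply: eq_bigr => rho _.
rewrite word_weight_scal; case: ifP => [/andP[h1 h2]|hv].
  have hf := SYTe_fits h1 h2.
  exact: (tableau_term he N q0 hq hf).
(* The sum over all row words reduces to admissible tableaux: a nonzero weight forces [fits], hence
   a tableau. *)
have [->|/(word_weight_neq0_fits he) hf] := eqVneq (word_weight qq N (kfun e) (word (extend rho) n)) 0.
  by rewrite scalE rmorph0 mul0r.
by rewrite (fits_is_partition he hf) (fits_is_SYTe he hf) in hv.
Qed.
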